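(* Let $V$ be a real vector space of dimension $2n$. Every maximal isotropic $L$ in $(V\oplus V^* )\otimes\mathbb{C}$ corresponds to a pure spinor line generated by $$\varphi_L=\exp(B+i\omega)\,\Omega,$$ where $B,\omega$ are real 2-forms and $\Omega=\theta_1\wedge\cdots\wedge\theta_k$ for some linearly independent complex 1-forms $(\theta_1,\dots,\theta_k)$; the integer $k$ is the type of the maximal isotropic. The maximal isotropic is of real index zero if and only if $$\omega^{n-k}\wedge\Omega\wedge\overline\Omega\neq0,$$ or in other words: (a) $(\theta_1,\dots,\theta_k,\overline\theta_1,\dots,\overline\theta_k)$ are linearly independent, and (b) $\omega$ is nondegenerate when restricted to the real $(2n-2k)$-dimensional subspace $\Delta\le V$ defined by $\Delta=\operatorname{Ker}(\Omega\wedge\overline\Omega)$.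
   Context: $(V\oplus V^* )\otimes\mathbb{C}$ carries the complex bilinear extension of $\langle X+\xi,Y+\eta\rangle=\frac12(\xi(Y)+\eta(X))$; a maximal isotropic is an isotropic complex subspace of dimension $2n$. The Clifford action on $\wedge^\bullet V^*\otimes\mathbb{C}$ is $(X+\xi)\cdot\varphi=i_X\varphi+\xi\wedge\varphi$. A line generated by $\varphi$ is a pure spinor line corresponding to $L$ if $L=\{v\in(V\oplus V^* )\otimes\mathbb{C} : v\cdot\varphi=0\}$ and $L$ is maximal isotropic. The type $k$ of $L$ is the complex codimension of the projection of $L$ to $V\otimes\mathbb{C}$. The real index of $L$ is $\dim_{\mathbb{C}}L\cap\overline L$. $\operatorname{Ker}(\Omega\wedge\overline\Omega)=\{X\in V : i_X(\Omega\wedge\overline\Omega)=0\}$. If $k>n$ then $\Omega\wedge\overline\Omega=0$ and the displayed nonvanishing condition is understood to fail. *)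

(* Defs.v *)
From HB Require Import structures.
From mathcomp Require Import all_boot all_order all_algebra.
From mathcomp Require Import complex.
From mathcomp Require Import boolp classical_sets functions reals.

Set Implicit Arguments.
Unset Strict Implicit.
Unset Printing Implicit Defensive.

Import Order.TTheory GRing.Theory Num.Theory.
Local Open Scope ring_scope.

(** * Complexification: [Cplx x y] stands for x (x) 1 + y (x) i in E (x) C *)

Record complexify (E : Type) := Cplx { cre : E; cim : E }.

Definition complexify_pair (E : Type) (v : complexify E) : E * E :=
  (cre v, cim v).
Definition pair_complexify (E : Type) (p : E * E) : complexify E :=
  Cplx p.1 p.2.
Lemma complexify_pairK (E : Type) :
  cancel (@complexify_pair E) (@pair_complexify E).
Proof. by case. Qed.

HB.instance Definition _ (E : choiceType) :=
  Choice.copy (complexify E) (can_type (@complexify_pairK E)).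

Section ComplexifyModule.
Context {R : rcfType} {E : lmodType R}.
Implicit Types (u v w : complexify E) (a b : R[i]).

Definition complexify_add u v := Cplx (cre u + cre v) (cim u + cim v).
Definition complexify_opp u := Cplx (- cre u) (- cim u).
Definition complexify_scale a u :=
  Cplx (complex.Re a *: cre u - complex.Im a *: cim u)
       (complex.Re a *: cim u + complex.Im a *: cre u).

Fact complexify_addA : associative complexify_add.
Proof. by move=> u v w; rewrite /complexify_add /= !addrA. Qed.
Fact complexify_addC : commutative complexify_add.
Proof.
by move=> u v; rewrite /complexify_add (addrC (cre u)) (addrC (cim u)).
Qed.
Fact complexify_add0 : left_id (Cplx 0 0) complexify_add.
Proof. by case=> x y; rewrite /complexify_add /= !add0r. Qed.
Fact complexify_addN : left_inverse (Cplx 0 0) complexify_opp complexify_add.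
Proof. by case=> x y; rewrite /complexify_add /= !addNr. Qed.

HB.instance Definition _ := GRing.isZmodule.Build (complexify E)
  complexify_addA complexify_addC complexify_add0 complexify_addN.

Fact complexify_scaleA a b u :
  complexify_scale a (complexify_scale b u) = complexify_scale (a * b) u.
Proof.
case: a b u => [a1 a2] [b1 b2] [x y]; rewrite /complexify_scale /=.
rewrite !scalerDr !scalerN !scalerA !scalerBl !scalerDl !opprD.
by congr Cplx; rewrite -!addrA; congr (_ + _); rewrite [RHS]addrC -addrA.
Qed.
Fact complexify_scale1 : left_id 1 complexify_scale.
Proof.
by case=> x y; rewrite /complexify_scale /= !scale1r !scale0r subr0 addr0.
Qed.
Fact complexify_scaleDr : right_distributive complexify_scale +%R.
Proof.
case=> a1 a2 [x y] [z t].
congr Cplx; rewrite /= !scalerDr ?opprD -!addrA; congr (_ + _);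
  by rewrite addrCA.
Qed.
Fact complexify_scaleDl u : {morph complexify_scale^~ u : a b / a + b}.
Proof.
case: u => x y [a1 a2] [b1 b2].
congr Cplx; rewrite /= !scalerDl ?opprD -!addrA; congr (_ + _);
  by rewrite addrCA.
Qed.

HB.instance Definition _ := GRing.Zmodule_isLmodule.Build R[i] (complexify E)
  complexify_scaleA complexify_scale1 complexify_scaleDr complexify_scaleDl.

Lemma creD u v : cre (u + v) = cre u + cre v. Proof. by []. Qed.
Lemma cimD u v : cim (u + v) = cim u + cim v. Proof. by []. Qed.
Lemma creZ a u :
  cre (a *: u) = complex.Re a *: cre u - complex.Im a *: cim u.
Proof. by []. Qed.
Lemma cimZ a u :
  cim (a *: u) = complex.Re a *: cim u + complex.Im a *: cre u.
Proof. by []. Qed.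

Definition cconj v : complexify E := Cplx (cre v) (- cim v).

End ComplexifyModule.

Section ComplexifyVector.
Import VectorInternalTheory.
Context {R : rcfType} {E : vectType R}.

Fact complexify_vect_axiom : Vector.axiom (dim E) (complexify E).
Proof.
pose f (v : complexify E) : 'rV[R[i]]_(dim E) := \row_j
  Complex (v2r (cre v) 0 j)
          (v2r (cim v) 0 j).
pose g (r : 'rV[R[i]]_(dim E)) : complexify E := Cplx
  (r2v (\row_j complex.Re (r 0 j)))
  (r2v (\row_j complex.Im (r 0 j))).
exists f.
- move=> [a1 a2] u v; apply/rowP => j; rewrite !mxE.
  by congr Complex;
    rewrite ?creD ?cimD ?creZ ?cimZ !linearD ?linearN !linearZ /= !mxE ?mulrN.
- exists g.
  + case=> x y; congr Cplx; rewrite -[RHS]v2rK;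
      by congr (r2v _); apply/rowP => j; rewrite !mxE.
  + move=> r; apply/rowP => j.
    by rewrite !mxE /= !r2vK !mxE; case: (r 0 j).
Qed.

HB.instance Definition _ :=
  Lmodule_hasFinDim.Build R[i] (complexify E) complexify_vect_axiom.

Definition conjv (L : {vspace complexify E}) : {vspace complexify E} :=
  <<[seq cconj v | v <- vbasis L]>>%VS.

Lemma cconjK : involutive (@cconj R E).
Proof. by case=> x y; rewrite /cconj /= opprK. Qed.

Lemma cconjD : {morph @cconj R E : u v / u + v}.
Proof. by case=> x y [z t]; congr Cplx; rewrite /= opprD. Qed.

Lemma cconjZ a (v : complexify E) : cconj (a *: v) = (a^*)%C *: cconj v.
Proof.
case: a v => a b [x y]; rewrite /cconj.
by congr Cplx; rewrite /= scaleNr scalerN ?opprD ?opprK.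
Qed.

Lemma cconj_span (X : seq (complexify E)) v :
  v \in <<X>>%VS -> cconj v \in <<[seq cconj u | u <- X]>>%VS.
Proof.
elim: X v => [|x X IH] v /=.
  rewrite span_nil memv0 => /eqP->.
  by rewrite memv0 /cconj; apply/eqP; congr Cplx; rewrite /= oppr0.
rewrite !span_cons => /memv_addP[_ /vlineP[a ->]] [w wX ->].
rewrite cconjD cconjZ memv_add ?IH //.
by rewrite memvZ // memv_line.
Qed.

Lemma memv_conj (L : {vspace complexify E}) v :
  (v \in conjv L) = (cconj v \in L).
Proof.
have bL := span_basis (vbasisP L).
apply/idP/idP => [/cconj_span | vL]; last first.
  by rewrite -[v]cconjK; apply: cconj_span; rewrite bL.
by rewrite -map_comp (eq_map cconjK) map_id bL.
Qed.

End ComplexifyVector.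

(** * (V (+) V^* ) (x) C *)

Section Generalized.
Context {R : rcfType} {V : vectType R}.

Local Notation Vd := 'Hom(V, R^o).
Local Notation T := (V * Vd)%type.

Definition pairing (v w : T) : R := 2^-1 * (v.2 w.1 + w.2 v.1).

Definition cpairing (v w : complexify T) : R[i] :=
  Complex (pairing (cre v) (cre w) - pairing (cim v) (cim w))
          (pairing (cre v) (cim w) + pairing (cim v) (cre w)).

Definition cvec (v : complexify T) : complexify V :=
  Cplx (cre v).1 (cim v).1.
Definition ccov (v : complexify T) : complexify Vd :=
  Cplx (cre v).2 (cim v).2.

Fact cvec_linear : linear cvec.
Proof. by move=> a u v. Qed.
HB.instance Definition _ :=
  GRing.isLinear.Build R[i] (complexify T) (complexify V) _ cvec cvec_linear.

Definition isotropic (L : {vspace complexify T}) : Prop :=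
  forall v w, v \in L -> w \in L -> cpairing v w = 0.

Definition maximal_isotropic (L : {vspace complexify T}) : Prop :=
  isotropic L /\ \dim L = \dim {:V}.

Definition isotropic_type (L : {vspace complexify T}) : nat :=
  (\dim {:complexify V} - \dim (linfun cvec @: L))%N.

Definition real_index (L : {vspace complexify T}) : nat :=
  \dim (L :&: conjv L).

(** * The exterior algebra of V^* (x) C

  An element of the exterior algebra is a complex-valued function on lists of
  vectors that is R-multilinear and alternating: its degree p component is the
  restriction to lists of length p, and it vanishes on lists longer than dim V.
  All functions on lists form a complex vector space, with the pointwise
  operations (the pointwise product is never used). *)

Implicit Types (a b phi F : seq V -> R[i]).

Definition is_form phi : Prop :=
  (forall s1 s2 (c : R) x y,
     phi (s1 ++ (c *: x + y) :: s2)
     = c%:C%C * phi (s1 ++ x :: s2) + phi (s1 ++ y :: s2)) /\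
  (forall s1 s2 s3 x, phi (s1 ++ x :: s2 ++ x :: s3) = 0).

Definition homogeneous (p : nat) phi : Prop :=
  forall s, size s <> p -> phi s = 0.

Definition conj_form phi : seq V -> R[i] := fun s => ((phi s)^*)%C.

Definition real_form (p : nat) phi : Prop :=
  [/\ is_form phi, homogeneous p phi & conj_form phi = phi].

Definition one_form (xi : complexify Vd) : seq V -> R[i] := fun s =>
  if s is [:: x] then Complex (cre xi x) (cim xi x) else 0.

(* The signature of the shuffle that moves the positions selected by [m]
   before the other ones. *)
Fixpoint shuffle_inv (m : bitseq) : nat :=
  if m is c :: m' then ((if c then 0 else count id m') + shuffle_inv m')%N
  else 0%N.

(* With this normalization (no factorials), xi /\ eta maps (x, y) to
   xi x * eta y - xi y * eta x, and [contract x] is an antiderivation (see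
   [contract_wedge]). *)
Definition wedge a b : seq V -> R[i] := fun s =>
  \sum_(m : (size s).-tuple bool)
    (-1) ^+ shuffle_inv m * (a (mask m s) * b (mask (map negb m) s)).

Definition unit_form : seq V -> R[i] := fun s => (s == [::])%:R.

Definition wedge_power (j : nat) F : seq V -> R[i] := iter j (wedge F) unit_form.

Definition wedge_one_forms (theta : seq (complexify Vd)) : seq V -> R[i] :=
  foldr (fun xi => wedge (one_form xi)) unit_form theta.

(* Meant for F of degree 2, whose powers beyond the range of the sum vanish. *)
Definition exp_form F : seq V -> R[i] :=
  \sum_(0 <= j < (\dim {:V}).+1) (j`!%:R : R[i])^-1 *: wedge_power j F.

Definition contract (x : V) phi : seq V -> R[i] := fun s => phi (x :: s).

Lemma contract_wedge x a b :
  contract x (wedge a b) =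
  wedge (contract x a) b + wedge (fun s => (-1) ^+ size s * a s) (contract x b).
Proof.
apply/funext => s; rewrite /contract /wedge /=.
pose h (p : bool * (size s).-tuple bool) : (size s).+1.-tuple bool :=
  [tuple of p.1 :: p.2].
rewrite (reindex h) /=; last first.
  exists (fun t => (thead t, [tuple of behead t])) => [[c m]|t] _.
    by congr pair; apply/val_inj.
  by rewrite /h [RHS]tuple_eta; apply/val_inj.
transitivity (\sum_(c : bool) \sum_(m : (size s).-tuple bool)
  (-1) ^+ shuffle_inv (c :: m) *
   (a (mask (c :: m) (x :: s)) * b (mask (map negb (c :: m)) (x :: s)))).
  by rewrite pair_big.
rewrite big_bool /=; congr (_ + _); apply: eq_bigr => m _.
by rewrite size_mask ?size_tuple // exprD !mulrA [_ ^+ count _ _ * _]mulrC.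
Qed.

Definition ccontract (X : complexify V) phi : seq V -> R[i] :=
  contract (cre X) phi + 'i%C *: contract (cim X) phi.

Definition clifford (v : complexify T) phi : seq V -> R[i] :=
  ccontract (cvec v) phi + wedge (one_form (ccov v)) phi.

(* [phi != 0] because phi has to generate a line. *)
Definition pure_spinor (L : {vspace complexify T}) phi : Prop :=
  [/\ is_form phi, phi <> 0, maximal_isotropic L &
      forall v, v \in L <-> clifford v phi = 0].

Definition form_ker phi : set V := [set x | contract x phi = 0]%classic.

Definition nondegenerate_on (D : set V) (omega : seq V -> R[i]) : Prop :=
  forall x, D x -> (forall y, D y -> omega [:: x; y] = 0) -> x = 0.

End Generalized.

(* Main.v *)
From HB Require Import structures.
Require Import Defs.
From mathcomp Require Import all_boot all_order all_algebra.
From mathcomp Require Import complex.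
From mathcomp Require Import ring zify.
From mathcomp Require Import boolp classical_sets functions reals.

(* An element [v = X + xi] acts on [exp F /\ Omega], [F = B + i omega], by
     exp F /\ (i_X Omega + (i_X F + xi) /\ Omega);
   since [exp F] has invertible constant term and the two summands have different
   degrees, the annihilator of the spinor is
     { X + xi | theta_j (X) = 0 and xi + i_X F in span theta }.
   Conversely, if [E] is the projection of a maximal isotropic [L] and [S : E -> L]
   is a linear section, isotropy makes [F (X, Y) = - (S X) (Y)] alternating, and [L]
   is the annihilator above for [theta] a basis of [Ann E].

   [L] meets its conjugate nontrivially iff it contains a nonzero real vector
   [x + xi].  The case [x = 0] gives (a); given (a), such a vector with [x <> 0]
   amounts to [x] in the radical of [omega] restricted to [Delta].

   Let [Psi = Omega /\ conj Omega] be nonzero.  If [x <> 0] lies in the radical,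
   then [i_x omega] lies in the span of the theta's and their conjugates, so [i_x]
   kills the top form [omega^(n-k) /\ Psi], which therefore vanishes.  If the
   radical is trivial and [omega^(j+1) /\ Psi = 0], contracting with [Delta] shows
   that every covector wedges [omega^j /\ Psi] to zero, which by Euler's identity
   is impossible below the top degree unless [omega^j /\ Psi = 0] already. *)

Set Implicit Arguments.
Unset Strict Implicit.
Unset Printing Implicit Defensive.

Import Order.TTheory GRing.Theory Num.Theory.
Local Open Scope ring_scope.

(** * Algebra of the wedge product: bilinearity, associativity, graded commutativity, degrees *)

Section ExteriorAlgebra.
Context {R : rcfType} {V : vectType R}.
Local Notation Vd := 'Hom(V, R^o).
Local Notation form := (seq V -> R[i]).
Implicit Types (a b c phi psi F : form) (x y : V) (s t : seq V).
Implicit Types (xi eta : complexify Vd) (X Y : complexify V).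

(** The grading involution, equal to (-1)^p in degree p; it is the sign that the antiderivation rule
    puts on the left factor. *)
Definition signed a : form := fun s => (-1) ^+ size s * a s.

(** Weaker than homogeneity of degree [p], so that mixed even forms such as exponentials have parity
    0. Only [p] modulo 2 matters, hence contraction may raise the index and no truncated predecessor
    occurs. *)
Definition parity (p : nat) a := signed a = (-1) ^+ p *: a.

Lemma wedge_nil a b : wedge a b [::] = a [::] * b [::].
Proof.
rewrite /wedge (big_pred1 [tuple]) /= ?expr0 ?mul1r // => m.
by rewrite (tuple0 m).
Qed.

(** The antiderivation rule read at a list of arguments. It replaces shuffle sums by induction on
    that list in the proofs of associativity and graded commutativity. *)
Lemma wedge_cons a b x s :
  wedge a b (x :: s) = wedge (contract x a) b s + wedge (signed a) (contract x b) s.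
Proof. by have /(congr1 (@^~ s)) := contract_wedge x a b. Qed.

Lemma wedgeDl a a' b : wedge (a + a') b = wedge a b + wedge a' b.
Proof.
apply/funext => s; rewrite !addrfctE /= /wedge -big_split; apply: eq_bigr => m _ /=.
by rewrite !mulrDl mulrDr.
Qed.

Lemma wedgeDr a b b' : wedge a (b + b') = wedge a b + wedge a b'.
Proof.
apply/funext => s; rewrite !addrfctE /= /wedge -big_split; apply: eq_bigr => m _ /=.
by rewrite !mulrDr.
Qed.

Lemma wedgeZl k a b : wedge (k *: a) b = k *: wedge a b.
Proof.
apply/funext => s; rewrite !scalrfctE /= /wedge scaler_sumr; apply: eq_bigr => m _ /=.
by rewrite /GRing.scale /= [RHS]mulrCA !mulrA.
Qed.

Lemma wedgeZr k a b : wedge a (k *: b) = k *: wedge a b.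
Proof.
apply/funext => s; rewrite !scalrfctE /= /wedge scaler_sumr; apply: eq_bigr => m _ /=.
by rewrite /GRing.scale /= [k * (_ * _)]mulrCA; congr (_ * _); rewrite mulrCA.
Qed.

Lemma wedge0l b : wedge 0 b = 0.
Proof. by rewrite -[0](scale0r (0 : form)) wedgeZl !scale0r. Qed.

Lemma wedge0r a : wedge a 0 = 0.
Proof. by rewrite -[0](scale0r (0 : form)) wedgeZr !scale0r. Qed.

Lemma wedgeNl a b : wedge (- a) b = - wedge a b.
Proof. by rewrite -scaleN1r wedgeZl scaleN1r. Qed.

Lemma wedgeNr a b : wedge a (- b) = - wedge a b.
Proof. by rewrite -scaleN1r wedgeZr scaleN1r. Qed.

Lemma wedge_sumr I (r : seq I) (P : pred I) a (f : I -> form) :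
  wedge a (\sum_(i <- r | P i) f i) = \sum_(i <- r | P i) wedge a (f i).
Proof. by apply: (big_morph (wedge a)) => [? ?|]; rewrite ?wedgeDr ?wedge0r. Qed.

Lemma contractD x a b : contract x (a + b) = contract x a + contract x b.
Proof. by []. Qed.

Lemma contractZ x k a : contract x (k *: a) = k *: contract x a.
Proof. by []. Qed.

Lemma signedZ k a : signed (k *: a) = k *: signed a.
Proof. by apply/funext => s; rewrite /signed !scalrfctE /GRing.scale /= mulrCA. Qed.

Lemma signedD a b : signed (a + b) = signed a + signed b.
Proof. by apply/funext => s; rewrite /signed !addrfctE mulrDr. Qed.

Lemma contract_signed x a : contract x (signed a) = - signed (contract x a).
Proof. by apply/funext => s; rewrite /signed /contract opprfctE /= exprS mulN1r mulNr. Qed.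

Lemma signed_wedge a b : signed (wedge a b) = wedge (signed a) (signed b).
Proof.
apply/funext => s; elim: s a b => [|x s IH] a b.
  by rewrite /signed !wedge_nil expr0 !mul1r.
rewrite wedge_cons {1}/signed wedge_cons exprS mulN1r mulNr mulrDr opprD.
rewrite -/(signed (wedge _ _) s) IH contract_signed wedgeNl; congr (_ + _).
by rewrite -/(signed (wedge _ _) s) IH contract_signed wedgeNr.
Qed.

Lemma wedgeA a b c : wedge a (wedge b c) = wedge (wedge a b) c.
Proof.
apply/funext => s; elim: s a b c => [|x s IH] a b c.
  by rewrite !wedge_nil mulrA.
rewrite !wedge_cons !contract_wedge !(wedgeDl, wedgeDr) !addrfctE signed_wedge.
by rewrite -!IH addrA.
Qed.

Lemma parity_contract p a x : parity p a -> parity p.+1 (contract x a).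
Proof.
rewrite /parity => pa; rewrite -[signed _]opprK -contract_signed pa contractZ.
by rewrite exprS mulN1r scaleNr.
Qed.

(** When [b] has degree q, [iter p signed b] is (-1)^(pq) times [b]; in this form the sign makes
    sense for inhomogeneous [b] too. *)
Lemma wedgeC p a b : parity p a -> wedge a b = wedge (iter p signed b) a.
Proof.
move=> pa; apply/funext => s; elim: s p a b pa => [|x s IH] p a b pa.
  rewrite !wedge_nil mulrC; congr (_ * _).
  by elim: p {pa} => //= p ->; rewrite /signed expr0 mul1r.
rewrite !wedge_cons (IH p.+1) ?iterS; last exact: parity_contract.
rewrite addrC; congr (_ + _); rewrite pa wedgeZl scalrfctE (IH p) //.
have -> : contract x (iter p signed b) = (-1) ^+ p *: iter p signed (contract x b).
  elim: p {IH pa} => [|p IHp] /=; first by rewrite scale1r.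
  by rewrite contract_signed IHp signedZ exprS mulN1r scaleNr.
by rewrite wedgeZl.
Qed.

Lemma wedgeC_even a b : parity 0 a -> wedge a b = wedge b a.
Proof. exact: wedgeC. Qed.

Lemma parity_wedge p q a b : parity p a -> parity q b -> parity (p + q) (wedge a b).
Proof.
by rewrite /parity signed_wedge => -> ->; rewrite wedgeZl wedgeZr scalerA exprD.
Qed.

Lemma homogeneous_parity p a : homogeneous p a -> parity p a.
Proof.
move=> ha; apply/funext => s; rewrite /signed scalrfctE.
by have [->//|/eqP/ha->] := eqVneq (size s) p; rewrite mulr0 scaler0.
Qed.

Lemma homogeneous_wedge p q a b :
  homogeneous p a -> homogeneous q b -> homogeneous (p + q) (wedge a b).
Proof.
move=> ha hb s ss; rewrite /wedge big1 // => m _.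
have [e|/eqP/ha->] := eqVneq (size (mask m s)) p; last by rewrite mul0r mulr0.
have [e'|/eqP/hb->] := eqVneq (size (mask (map negb m) s)) q; last by rewrite !mulr0.
case: ss; rewrite -e -e' !size_mask ?size_map ?size_tuple //.
by rewrite count_map -[LHS](size_tuple m) -(count_predC id m).
Qed.

Lemma homogeneous_contract p a x : homogeneous p.+1 a -> homogeneous p (contract x a).
Proof. by move=> ha s ss; apply: ha => -[]. Qed.

Lemma homogeneous0_contract a x : homogeneous 0 a -> contract x a = 0.
Proof. by move=> ha; apply/funext => s; apply: ha. Qed.

Lemma homogeneousZ p k a : homogeneous p a -> homogeneous p (k *: a).
Proof. by move=> ha s ss; rewrite scalrfctE ha // scaler0. Qed.

Lemma homogeneousD p a b : homogeneous p a -> homogeneous p b -> homogeneous p (a + b).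
Proof. by move=> ha hb s ss; rewrite addrfctE ha // hb // addr0. Qed.

Lemma homogeneous_unit : homogeneous 0 (@unit_form R V).
Proof. by case. Qed.

Lemma homogeneous_one xi : homogeneous 1 (one_form xi).
Proof. by case=> [|x [|y s]]. Qed.

Lemma wedge_unitl a : wedge unit_form a = a.
Proof.
apply/funext => s; elim: s a => [|x s IH] a.
  by rewrite wedge_nil /unit_form mul1r.
rewrite wedge_cons homogeneous0_contract ?wedge0l; last exact: homogeneous_unit.
by rewrite (homogeneous_parity homogeneous_unit) scale1r IH add0r.
Qed.

Lemma wedge_unitr a : wedge a unit_form = a.
Proof.
by rewrite -(@wedgeC_even unit_form) ?wedge_unitl //; apply/homogeneous_parity/homogeneous_unit.
Qed.

(* The component of lowest degree of [b] survives in [a /\ b]. *)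
Lemma wedge_unipotent_eq0 a b : a [::] = 1 -> wedge a b = 0 -> b = 0.
Proof.
move=> a1 ab0; suff H n s : (size s < n)%N -> b s = 0.
  by apply/funext => s; apply: (H (size s).+1).
elim: n s => // n IH s; rewrite ltnS => sn.
(* The mask selecting nothing contributes [a [::] * b s] up to sign; any other mask hands fewer
   arguments to [b], where [b] vanishes by induction. *)
have /(congr1 (@^~ s)) := ab0; rewrite /wedge (bigD1 [tuple of nseq (size s) false]) //=.
rewrite big1 ?addr0.
  rewrite map_nseq mask_false mask_true // a1 mul1r.
  set e := (-1) ^+ _ => /(congr1 ( *%R e)).
  by rewrite /e signrMK => ->; rewrite mulr0.
move=> m mn; rewrite [b _]IH ?mulr0 //; apply: leq_trans sn.
rewrite size_mask ?size_map ?size_tuple // count_map.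
rewrite -[X in (_ < X)%N](size_tuple m) -(count_predC id m).
rewrite -[X in (X < _)%N]add0n ltn_add2r -has_count.
apply: contraNT mn; rewrite -all_predC => e; apply/eqP/val_inj => /=.
by rewrite -[X in nseq X](size_tuple m); apply/all_pred1P; apply: sub_all e => -[].
Qed.

(** * Alternating forms *)

(* Contracting repeatedly reduces multilinearity and alternation to the first
   one or two arguments, where they can be proved by the antiderivation rule. *)
Lemma is_formP phi :
  is_form phi <->
  (forall s (k : R) x y t, phi (s ++ (k *: x + y) :: t) =
      k%:C%C * phi (s ++ x :: t) + phi (s ++ y :: t)) /\
  (forall s x t, phi (s ++ x :: x :: t) = 0).
Proof.
split=> [[lin alt]|[lin alt]]; split=> //.
- by move=> s x t; apply: (alt s [::] t).
have swap s x y t : phi (s ++ x :: y :: t) = - phi (s ++ y :: x :: t).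
  have := alt s (1 *: x + y) t; rewrite lin -cat_rcons lin cat_rcons alt mulr0 add0r.
  by rewrite -(cat_rcons y s) lin !cat_rcons alt addr0 !mul1r => /eqP; rewrite addr_eq0 => /eqP.
move=> s1 s2 s3 x; elim: s2 s1 => [|y s2 IH] s1 //=.
by rewrite swap -cat_rcons IH oppr0.
Qed.

Lemma is_form_linear phi x y (k : R) : is_form phi ->
  contract (k *: x + y) phi = k%:C%C *: contract x phi + contract y phi.
Proof. by case=> lin _; apply/funext => s; apply: (lin [::]). Qed.

Lemma is_form_contract2 phi x : is_form phi -> contract x (contract x phi) = 0.
Proof. by case=> _ alt; apply/funext => s; apply: (alt [::] [::]). Qed.

Lemma is_form_contract phi x : is_form phi -> is_form (contract x phi).
Proof.
case=> lin alt; split=> [s1 s2 k u v|s1 s2 s3 u]; rewrite /contract -!cat_cons.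
  exact: lin.
exact: alt.
Qed.

Lemma is_form0 : is_form (0 : form).
Proof. by split=> [*|//]; rewrite /= mulr0 addr0. Qed.

Lemma is_formD a b : is_form a -> is_form b -> is_form (a + b).
Proof.
move=> [la aa] [lb ab]; split=> [s1 s2 k x y|s1 s2 s3 x]; rewrite !addrfctE.
  by rewrite la lb mulrDr addrACA.
by rewrite aa ab addr0.
Qed.

Lemma is_formZ k a : is_form a -> is_form (k *: a).
Proof.
move=> [la aa]; split=> [s1 s2 l x y|s1 s2 s3 x]; rewrite !scalrfctE /GRing.scale /=.
  by rewrite la mulrDr mulrCA.
by rewrite aa mulr0.
Qed.

Lemma is_form_sum I (r : seq I) (P : pred I) (f : I -> form) :
  (forall i, P i -> is_form (f i)) -> is_form (\sum_(i <- r | P i) f i).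
Proof. by move=> ff; apply: big_ind => //; [exact: is_form0|exact: is_formD]. Qed.

Lemma is_form_signed a : is_form a -> is_form (signed a).
Proof.
move=> [la aa]; split=> [s1 s2 k x y|s1 s2 s3 x]; rewrite /signed.
  by rewrite la !size_cat /= mulrDr mulrCA.
by rewrite aa mulr0.
Qed.

Lemma is_form_unit : is_form (@unit_form R V).
Proof.
split=> [s1 s2 k x y|s1 s2 s3 x]; rewrite /unit_form; case: s1 => //=.
  by rewrite mulr0 addr0.
by rewrite mulr0 addr0.
Qed.

Lemma is_form_wedge a b : is_form a -> is_form b -> is_form (wedge a b).
Proof.
suff H n c d : is_form c -> is_form d ->
    (forall s1 s2 (k : R) x y, (size s1 < n)%N ->
       wedge c d (s1 ++ (k *: x + y) :: s2) =
       k%:C%C * wedge c d (s1 ++ x :: s2) + wedge c d (s1 ++ y :: s2)) /\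
    (forall s x t, (size s < n)%N -> wedge c d (s ++ x :: x :: t) = 0).
  move=> fa fb; apply/is_formP; split.
    by move=> s1 k x y s2; apply: (H (size s1).+1 a b fa fb).1.
  by move=> s x t; apply: (H (size s).+1 a b fa fb).2.
elim: n c d => // n IH c d fc fd; split.
  case=> [|z s1] s2 k x y; rewrite /= ?ltnS => sn; rewrite !wedge_cons.
    rewrite !is_form_linear // wedgeDl wedgeZl wedgeDr wedgeZr !addrfctE !scalrfctE.
    by rewrite mulrDr addrACA.
  rewrite (IH _ _ (is_form_contract z fc) fd).1 //.
  rewrite (IH _ _ (is_form_signed fc) (is_form_contract z fd)).1 //.
  by rewrite mulrDr addrACA.
(* At the front of the list, contracting twice with [x] kills either factor, and the two mixed terms
   cancel because contraction anticommutes with [signed]. *)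
case=> [|z s] x t; rewrite /= ?ltnS => sn.
  rewrite !wedge_cons !is_form_contract2 // wedge0l wedge0r contract_signed wedgeNl.
  by rewrite opprfctE add0r addr0 addrN.
rewrite wedge_cons (IH _ _ (is_form_contract z fc) fd).2 //.
by rewrite (IH _ _ (is_form_signed fc) (is_form_contract z fd)).2 // addr0.
Qed.

Lemma is_form_one xi : is_form (one_form xi).
Proof.
case: xi => xr xj; split=> [[|z [|w s1]] [|t s2] k x y|[|z [|w s1]] [|t s2] s3 x] //=;
  rewrite ?mulr0 ?addr0 //.
rewrite !linearP /=; apply/eqP; rewrite eq_complex /= /GRing.scale /=.
by rewrite !mul0r subr0 addr0 !eqxx.
Qed.

Lemma is_form_power j F : is_form F -> is_form (wedge_power j F).
Proof. by move=> fF; elim: j => [|j IH]; [exact: is_form_unit|exact: is_form_wedge]. Qed.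

Lemma is_form_exp F : is_form F -> is_form (exp_form F).
Proof. by move=> fF; apply: is_form_sum => j _; apply/is_formZ/is_form_power. Qed.

Lemma is_form_wedge_one_forms th : is_form (wedge_one_forms th : form).
Proof.
by elim: th => [|xi th IH]; [exact: is_form_unit|apply: is_form_wedge => //; apply: is_form_one].
Qed.

Lemma homogeneous_power p j F : homogeneous p F -> homogeneous (j * p) (wedge_power j F).
Proof. by move=> hF; elim: j => [|j IH]; [exact: homogeneous_unit|exact: homogeneous_wedge]. Qed.

Lemma homogeneous_wedge_one_forms th :
  homogeneous (size th) (wedge_one_forms th : form).
Proof.
elim: th => [|xi th IH]; first exact: homogeneous_unit.
by apply: (homogeneous_wedge (p := 1)) => //; apply: homogeneous_one.
Qed.

Lemma is_form_contract0 phi : is_form phi -> contract 0 phi = 0.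
Proof.
move=> fphi; have := is_form_linear 0 0 (-1) fphi.
by rewrite scaler0 addr0 rmorphN rmorph1 scaleN1r addNr.
Qed.

Lemma is_form_contract_sum phi I (r : seq I) (k : I -> R) (u : I -> V) :
  is_form phi ->
  contract (\sum_(i <- r) k i *: u i) phi = \sum_(i <- r) (k i)%:C%C *: contract (u i) phi.
Proof.
move=> fphi; elim: r => [|i r IH]; first by rewrite !big_nil is_form_contract0.
by rewrite !big_cons is_form_linear // IH.
Qed.

(** A vector in the span of those after it is expanded over them, and every resulting term has a
    repeated argument. *)
Lemma form_nonfree_eq0 phi s : is_form phi -> ~~ free s -> phi s = 0.
Proof.
elim: s phi => [|x s IH] phi fphi; first by rewrite nil_free.
rewrite free_cons negb_and negbK => /orP[xs|ns]; last first.
  exact: (IH (contract x phi)) (is_form_contract x fphi) ns.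
have /coord_span -> : x \in <<in_tuple s>>%VS by [].
rewrite -/(contract _ phi s) is_form_contract_sum // fct_sumE big1 // => i _.
have : (in_tuple s)`_i \in s by apply: mem_nth.
rewrite scalrfctE; move: (coord _ _ _) ((in_tuple s)`_i) => c z /splitPr[s1 s2].
by rewrite /contract (fphi.2 [::]) scaler0.
Qed.

Lemma form_large_eq0 phi s : is_form phi -> (\dim {:V} < size s)%N -> phi s = 0.
Proof.
move=> fphi lt; apply: form_nonfree_eq0 => //; apply: contraL lt.
by rewrite -leqNgt => /eqnP <-; apply/dimvS/subvf.
Qed.
End ExteriorAlgebra.

(** * Duality *)

Section Perp.
Context {K : fieldType} {A B : vectType K} (g : A -> B -> K).
Context (gl : forall x, linear (fun a => g a x : K^o)).
Context (gr : forall a, linear (fun x => g a x : K^o)).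
Implicit Types (E : {vspace B}).

(** Pairing with a basis of [E] presents the orthogonal of [E] as a kernel, with a dimension bound
    from rank and nullity. The pairing is abstract in order to cover real and complexified
    evaluation, each from both sides. *)
Definition perp_map E (a : A) : 'rV[K]_(\dim E) := \row_i g a (vbasis E)`_i.

Fact perp_map_linear E : linear (perp_map E).
Proof. by move=> k a b; apply/rowP => i; rewrite !mxE gl. Qed.

Definition perp_linear E : {linear A -> 'rV[K]_(\dim E)} :=
  HB.pack (perp_map E)
    (GRing.isLinear.Build K A 'rV[K]_(\dim E) *:%R (perp_map E) (perp_map_linear E)).

Definition perp E : {vspace A} := lker (linfun (perp_linear E)).

Lemma mem_perp E a : a \in perp E <-> forall x, x \in E -> g a x = 0.
Proof.
rewrite memv_ker lfunE /=; split=> [/eqP/rowP e x xE|e].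
  pose ga : {linear B -> K^o} :=
    HB.pack (g a : B -> K^o) (GRing.isLinear.Build K B K^o *:%R (g a : B -> K^o) (gr a)).
  rewrite (coord_vbasis xE) -[g a _]/(ga _) linear_sum big1 // => i _.
  by rewrite linearZ /=; have := e i; rewrite !mxE => ->; rewrite scaler0.
by apply/eqP/rowP => i; rewrite !mxE e // vbasis_mem // mem_nth // size_tuple.
Qed.

Lemma dim_perp_ge E : (\dim {:A} <= \dim (perp E) + \dim E)%N.
Proof.
rewrite -[X in (X <= _)%N](limg_ker_dim (linfun (perp_linear E))) capfv leq_add2l.
by apply: leq_trans (dimvS (subvf _)) _; rewrite dimvf /dim /= mul1n.
Qed.

Context (g_nondeg : forall a, (forall x, g a x = 0) -> a = 0).
Context (dimAB : \dim {:A} = \dim {:B}).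

(** The lower bound holds for [E] and for a complement of [E]. By nondegeneracy the two orthogonals
    meet only in 0, so their dimensions add up to at most that of [A], which forces equality in both
    bounds. *)
Lemma dim_perp E : (\dim (perp E) + \dim E)%N = \dim {:A}.
Proof.
apply/eqP; rewrite eqn_leq dim_perp_ge andbT.
have cap0 : (perp E :&: perp E^C = 0)%VS.
  apply/eqP; rewrite -subv0; apply/subvP => a /memv_capP[/mem_perp aE /mem_perp aC].
  rewrite memv0; apply/eqP/g_nondeg => x.
  have /memv_addP[y yE [z zC ->]] : x \in (E + E^C)%VS by rewrite addv_complf memvf.
  by have := gr a 1 y z; rewrite !scale1r => ->; rewrite aE // aC // addr0.
have := dimvS (subvf (perp E + perp E^C)%VS); rewrite dimv_disjoint_sum //.
have := dim_perp_ge E^C.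
have : (\dim E + \dim E^C)%N = \dim {:A}.
  by rewrite -dimv_disjoint_sum ?capv_compl // addv_complf.
lia.
Qed.

(** Otherwise adjoining [x] to [E] would leave the orthogonal unchanged, against the dimension
    formula. *)
Lemma perp_sep E x : x \notin E -> exists2 a, a \in perp E & g a x != 0.
Proof.
move=> xE; apply/exists2P; apply: contrapT => /forallNP H.
have : (perp E <= perp (E + <[x]>))%VS.
  apply/subvP => a aE; apply/mem_perp => _ /memv_addP[y yE [_ /vlineP[k ->] ->]].
  have gax : g a x = 0.
    by apply: contrapT => /eqP n; apply: (H a).
  have -> : g a (y + k *: x) = k * g a x + g a y by rewrite addrC; apply: gr.
  by rewrite gax mulr0 add0r; move/mem_perp: aE; apply.
move=> /dimvS; rewrite -(leq_add2r (\dim E)) dim_perp -(dim_perp (E + <[x]>)) leq_add2l.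
move=> le; have /eqP : (E + <[x]> == E)%VS.
  by rewrite eq_sym eqEdim addvSl.
by move=> eE; case/negP: xE; rewrite -eE; apply: (subvP (addvSr _ _)); apply: memv_line.
Qed.
End Perp.

(** * Complex covectors, their evaluation on complex vectors, and annihilators *)

Section Covectors.
Context {R : rcfType} {V : vectType R}.
Local Notation Vd := 'Hom(V, R^o).
Local Notation form := (seq V -> R[i]).
Implicit Types (a b c phi psi F : form) (x y : V) (s t : seq V).
Implicit Types (xi eta : complexify Vd) (X Y : complexify V).

Definition ceval xi X : R[i] :=
  Complex (cre xi (cre X) - cim xi (cim X)) (cre xi (cim X) + cim xi (cre X)).

Lemma ceval_linearl X : linear (fun xi => ceval xi X : R[i]^o).
Proof.
move=> [k l] xi eta; rewrite /ceval creD cimD creZ cimZ; do 4!rewrite !lfunE /=.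
by apply/eqP; rewrite eq_complex /= /GRing.scale /=; apply/andP; split; apply/eqP; ring.
Qed.

Lemma ceval_linearr xi : linear (fun X => ceval xi X : R[i]^o).
Proof.
move=> [k l] X Y; rewrite /ceval creD cimD creZ cimZ !linearD !linearN !linearZ /=.
by apply/eqP; rewrite eq_complex /= /GRing.scale /=; apply/andP; split; apply/eqP; ring.
Qed.

Lemma cevalE xi x : ceval xi (Cplx x 0) = one_form xi [:: x].
Proof. by rewrite /ceval /= !raddf0 addr0 add0r. Qed.

Lemma real_covector_sep x : (forall f : Vd, f x = 0) -> x = 0.
Proof.
move=> H; apply/eqP; rewrite -memv0; apply: contrapT => /negP n.
have gl y : linear (fun f : Vd => f y : R^o) by move=> k f h; rewrite !lfunE /= lfunE.
have gr (f : Vd) : linear (fun y => f y : R^o) by move=> k y z; rewrite linearP.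
have gn (f : Vd) : (forall y, f y = 0) -> f = 0 by move=> f0; apply/lfunP => y; rewrite f0 lfunE.
have dd : \dim {:Vd} = \dim {:V} by rewrite !dimvf /dim /= muln1.
by have [f _ /negP[]] := perp_sep gl gr gn dd n; rewrite H.
Qed.

Lemma ceval_nondegl xi : (forall X, ceval xi X = 0) -> xi = 0.
Proof.
move=> H; case: xi H => f h H; have {}H x : f x = 0 /\ h x = 0.
  by have := H (Cplx x 0); rewrite cevalE /= => -[].
by congr Cplx; apply/lfunP => x; rewrite lfunE /=; case: (H x).
Qed.

Lemma ceval_nondegr X : (forall xi, ceval xi X = 0) -> X = 0.
Proof.
move=> H; case: X H => x y H; congr Cplx; apply: real_covector_sep => f;
  by have := H (Cplx f 0); rewrite /ceval /= !lfunE /= subr0 addr0 => -[].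
Qed.

Lemma dim_complexify (E : vectType R) : \dim {:complexify E} = \dim {:E}.
Proof. by rewrite !dimvf. Qed.

Lemma dim_cvec_ccov : \dim {:complexify Vd} = \dim {:complexify V}.
Proof. by rewrite !dim_complexify !dimvf /dim /= muln1. Qed.

(** For a maximal isotropic, [ann] of its projection supplies the theta's, and [coann] of their span
    gives the projection back. *)
Definition ann (E : {vspace complexify V}) : {vspace complexify Vd} :=
  perp ceval_linearl E.
Definition coann (S : {vspace complexify Vd}) : {vspace complexify V} :=
  @perp _ _ _ (fun X xi => ceval xi X) ceval_linearr S.

Lemma mem_ann E xi : xi \in ann E <-> forall X, X \in E -> ceval xi X = 0.
Proof. exact: (mem_perp ceval_linearl ceval_linearr). Qed.
Lemma mem_coann S X : X \in coann S <-> forall xi, xi \in S -> ceval xi X = 0.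
Proof. exact: (mem_perp (g := fun X xi => ceval xi X) ceval_linearr ceval_linearl). Qed.

Lemma dim_ann E : (\dim (ann E) + \dim E)%N = \dim {:V}.
Proof.
rewrite (dim_perp ceval_linearl ceval_linearr ceval_nondegl dim_cvec_ccov).
by rewrite dim_cvec_ccov dim_complexify.
Qed.

Lemma dim_coann S : (\dim (coann S) + \dim S)%N = \dim {:V}.
Proof.
rewrite (dim_perp (g := fun X xi => ceval xi X) ceval_linearr ceval_linearl) //.
- by rewrite dim_complexify.
- exact: ceval_nondegr.
- by rewrite dim_cvec_ccov.
Qed.

Lemma ann_sep (E : {vspace complexify V}) X :
  X \notin E -> exists2 xi, xi \in ann E & ceval xi X != 0.
Proof.
exact: (perp_sep ceval_linearl ceval_linearr ceval_nondegl dim_cvec_ccov).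
Qed.

Lemma coann_sep (S : {vspace complexify Vd}) xi :
  xi \notin S -> exists2 X, X \in coann S & ceval xi X != 0.
Proof.
apply: (perp_sep (g := fun X xi => ceval xi X) ceval_linearr ceval_linearl).
- exact: ceval_nondegr.
- by rewrite dim_cvec_ccov.
Qed.

Lemma ceval_conj xi X : ceval (cconj xi) (cconj X) = ((ceval xi X)^*)%C.
Proof.
rewrite /ceval /= !linearN /=; apply/eqP; rewrite eq_complex /= !lfunE /=.
by rewrite opprK opprD eqxx /= !eqxx.
Qed.

Lemma ceval_real xi x y : ceval xi (Cplx x y) =
  ceval xi (Cplx x 0) + 'i%C * ceval xi (Cplx y 0).
Proof. 
rewrite /ceval /= !raddf0; apply/eqP; rewrite eq_complex /=.
by apply/andP; split; apply/eqP; ring.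
Qed.
End Covectors.

(** * Pure spinors *)

Section Spinors.
Context {R : rcfType} {V : vectType R}.
Local Notation Vd := 'Hom(V, R^o).
Local Notation form := (seq V -> R[i]).
Implicit Types (a b c phi psi F : form) (x y : V) (s t : seq V).
Implicit Types (xi eta : complexify Vd) (X Y : complexify V).
Implicit Types (th : seq (complexify Vd)).

Lemma signed_one xi : signed (one_form xi) = - one_form xi.
Proof. by rewrite (homogeneous_parity (@homogeneous_one _ _ xi)) scaleN1r. Qed.

Lemma wedge_one_oneC xi eta b :
  wedge (one_form xi) (wedge (one_form eta) b) = - wedge (one_form eta) (wedge (one_form xi) b).
Proof.
rewrite !wedgeA (wedgeC _ (homogeneous_parity (@homogeneous_one _ _ xi))) /=.
by rewrite signed_one !wedgeNl.
Qed.

Lemma wedge_one_one xi b : wedge (one_form xi) (wedge (one_form xi) b) = 0.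
Proof.
apply/funext => s; have /(congr1 (@^~ s)) := wedge_one_oneC xi xi b.
by rewrite opprfctE => /eqP; rewrite -addr_eq0 -mulr2n mulrn_eq0 => /eqP.
Qed.

Lemma one_form_linear k xi eta :
  one_form (k *: xi + eta) = k *: one_form xi + one_form eta.
Proof.
apply/funext => -[|x [|y s]]; rewrite !addrfctE !scalrfctE ?scaler0 ?addr0 //.
by rewrite -!cevalE; apply: (ceval_linearl (Cplx x 0)).
Qed.

Lemma one_formD xi eta : one_form (xi + eta) = one_form xi + one_form eta.
Proof. by rewrite -[xi]scale1r one_form_linear !scale1r. Qed.

Lemma ccontractE X phi s :
  ccontract X phi s = phi (cre X :: s) + 'i%C * phi (cim X :: s).
Proof. by []. Qed.

Lemma ccontractD X a b : ccontract X (a + b) = ccontract X a + ccontract X b.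
Proof. by apply/funext => s; rewrite !addrfctE !ccontractE mulrDr addrACA. Qed.

Lemma ccontractZ X k a : ccontract X (k *: a) = k *: ccontract X a.
Proof.
by apply/funext => s; rewrite !scalrfctE !ccontractE /GRing.scale /= mulrDr mulrCA.
Qed.

Lemma ccontract0 X : ccontract X 0 = 0 :> form.
Proof. by rewrite -[0](scale0r (0 : form)) ccontractZ !scale0r. Qed.

Lemma ccontract_sum X I (r : seq I) (P : pred I) (f : I -> form) :
  ccontract X (\sum_(i <- r | P i) f i) = \sum_(i <- r | P i) ccontract X (f i).
Proof. by apply: (big_morph (ccontract X)) => [? ?|]; rewrite ?ccontractD ?ccontract0. Qed.

Lemma ccontract_wedge X a b :
  ccontract X (wedge a b) = wedge (ccontract X a) b + wedge (signed a) (ccontract X b).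
Proof.
rewrite /ccontract !contract_wedge -/(signed a) wedgeDl wedgeDr wedgeZl wedgeZr.
by rewrite scalerDr addrACA.
Qed.

Lemma ccontract_real x phi : is_form phi -> ccontract (Cplx x 0) phi = contract x phi.
Proof. by move=> fphi; rewrite /ccontract /= is_form_contract0 // scaler0 addr0. Qed.

Lemma homogeneous_ccontract p (X : complexify V) phi :
  homogeneous p phi -> homogeneous p.-1 (ccontract X phi).
Proof.
move=> hphi s ss; rewrite ccontractE !hphi ?mulr0 ?addr0 //= => e; by apply: ss; rewrite -e.
Qed.

Lemma ccontract_unit X : ccontract X unit_form = 0 :> form.
Proof. by apply/funext => s; rewrite ccontractE mulr0 addr0. Qed.

Lemma ccontract_one X xi : ccontract X (one_form xi) = ceval xi X *: unit_form.
Proof.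
apply/funext => -[|z s]; rewrite scalrfctE ccontractE /unit_form; last first.
  by rewrite /= mulr0 addr0 scaler0.
rewrite -!cevalE /GRing.scale /= mulr1.
by case: X => x y; rewrite [RHS]ceval_real.
Qed.

Lemma ccontract_wedge_one X xi b :
  ccontract X (wedge (one_form xi) b) = ceval xi X *: b - wedge (one_form xi) (ccontract X b).
Proof.
by rewrite ccontract_wedge ccontract_one wedgeZl wedge_unitl signed_one wedgeNl.
Qed.

Lemma wedge_one_forms_cat th1 th2 :
  wedge_one_forms (th1 ++ th2) = wedge (wedge_one_forms th1) (wedge_one_forms th2) :> form.
Proof. by elim: th1 => [|xi th1 IH] /=; rewrite ?wedge_unitl // IH wedgeA. Qed.

Lemma wedge_one_mem th xi : xi \in th -> wedge (one_form xi) (wedge_one_forms th) = 0.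
Proof.
elim: th => //= eta th IH; rewrite in_cons => /orP[/eqP ->|/IH e].
  exact: wedge_one_one.
by rewrite wedge_one_oneC e wedge0r oppr0.
Qed.

Lemma wedge_one_span_eq0 th rho :
  (forall xi, xi \in th -> wedge (one_form xi) rho = 0) ->
  forall xi, xi \in <<th>>%VS -> wedge (one_form xi) rho = 0.
Proof.
move=> H xi xith; rewrite (coord_span (X := in_tuple th) xith).
elim/big_rec: _ => [|i eta _ IH].
  have -> : one_form 0 = 0 :> form; last by rewrite wedge0l.
  by apply/funext => -[|x [|y s]] //=; rewrite !lfunE.
by rewrite one_form_linear wedgeDl IH addr0 wedgeZl H ?scaler0 // mem_nth.
Qed.

Lemma wedge_one_span th xi : xi \in <<th>>%VS -> wedge (one_form xi) (wedge_one_forms th) = 0.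
Proof. by apply: wedge_one_span_eq0 => eta; apply: wedge_one_mem. Qed.

Lemma ccontract_wedge_one_forms X th : X \in coann <<th>>%VS ->
  ccontract X (wedge_one_forms th) = 0.
Proof.
move=> /mem_coann; elim: th => [|xi th IH] /= H; first exact: ccontract_unit.
rewrite ccontract_wedge_one H ?scale0r ?sub0r; last by rewrite memv_span ?mem_head.
by rewrite IH ?wedge0r ?oppr0 // => eta e; apply: H; rewrite span_cons (subvP (addvSr _ _)).
Qed.

(** Some [X] annihilates the later covectors but not the first one; contracting with [X] strips off
    the first factor, and induction applies. *)
Lemma wedge_one_forms_neq0 th : free th -> wedge_one_forms th <> 0 :> form.
Proof.
elim: th => [_|xi th IH] /=.
  by move=> /(congr1 (@^~ [::])) /eqP; rewrite /unit_form eqxx oner_eq0.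
rewrite free_cons => /andP[xith fth] e.
have [X Xth /negP[]] := coann_sep xith.
have := ccontract_wedge_one X xi (wedge_one_forms th).
rewrite e ccontract0 ccontract_wedge_one_forms // wedge0r subr0 => /esym/eqP.
by rewrite scaler_eq0 => /orP[//|/eqP/IH]; case.
Qed.

Lemma wedge_one_forms_eq0 th : ~~ free th -> wedge_one_forms th = 0 :> form.
Proof.
elim: th => [|xi th IH]; first by rewrite nil_free.
rewrite free_cons negb_and negbK => /orP[|/IH /= ->]; first exact: wedge_one_span.
by rewrite wedge0r.
Qed.

Lemma wedge_one_eq0 th xi : free th ->
  wedge (one_form xi) (wedge_one_forms th) = 0 <-> xi \in <<th>>%VS.
Proof.
move=> fth; split=> [e|]; last exact: wedge_one_span.
by apply: contraT => nxi; case: (@wedge_one_forms_neq0 (xi :: th)); rewrite ?free_cons ?nxi.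
Qed.

(** For [xi] in the span, [xi /\ Omega = 0]; contracting this with [X] gives
    [xi(X) Omega = xi /\ i_X Omega], so [i_X Omega = 0] forces [xi(X) = 0]. *)
Lemma ccontract_eq0 th X : free th ->
  ccontract X (wedge_one_forms th) = 0 <-> X \in coann <<th>>%VS.
Proof.
move=> fth; split=> [e|]; last exact: ccontract_wedge_one_forms.
apply/mem_coann => xi xith; have := ccontract_wedge_one X xi (wedge_one_forms th).
rewrite wedge_one_span // ccontract0 e wedge0r subr0 => /esym/eqP; rewrite scaler_eq0.
by case/orP => [/eqP//|/eqP/wedge_one_forms_neq0]; case.
Qed.

Lemma one_formP phi : is_form phi -> homogeneous 1 phi -> exists xi, phi = one_form xi.
Proof.
move=> [lphi _] hphi.
pose fr (x : V) : R^o := complex.Re (phi [:: x]).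
pose fi (x : V) : R^o := complex.Im (phi [:: x]).
have e k x y : phi [:: k *: x + y] = k%:C%C * phi [:: x] + phi [:: y] by apply: (lphi [::] [::]).
have lr : linear fr.
  move=> k x y; rewrite /fr e; case: (phi [:: x]) (phi [:: y]) => [a b] [c d] /=.
  by rewrite mul0r subr0.
have li : linear fi.
  move=> k x y; rewrite /fi e; case: (phi [:: x]) (phi [:: y]) => [a b] [c d] /=.
  by rewrite mul0r addr0.
pose gr : {linear V -> R^o} := HB.pack fr (GRing.isLinear.Build R V R^o *:%R fr lr).
pose gi : {linear V -> R^o} := HB.pack fi (GRing.isLinear.Build R V R^o *:%R fi li).
exists (Cplx (linfun gr) (linfun gi)); apply/funext => -[|x [|y s]] /=; try exact: hphi.
have er : linfun gr x = fr x := lfunE gr x.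
have ei : linfun gi x = fi x := lfunE gi x.
by rewrite er ei /fr /fi; case: (phi _).
Qed.

Lemma is_form_ccontract X phi : is_form phi -> is_form (ccontract X phi).
Proof. by move=> f; apply/is_formD/is_formZ; apply: is_form_contract. Qed.

Lemma ccontract_one_form X F : is_form F -> homogeneous 2 F ->
  exists xi, ccontract X F = one_form xi.
Proof.
move=> fF hF; apply: one_formP; first exact: is_form_ccontract.
exact: (homogeneous_ccontract (p := 2)).
Qed.

Lemma parity_power j F : parity 0 F -> parity 0 (wedge_power j F).
Proof.
move=> pF; elim: j => [|j IH]; last exact: (parity_wedge pF IH).
exact/homogeneous_parity/homogeneous_unit.
Qed.

Lemma homogeneous2_parity F : homogeneous 2 F -> parity 0 F.
Proof. by move=> hF; rewrite /parity (homogeneous_parity hF) sqrrN expr1n. Qed.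

(** Since [F] is even, [i_X F] moves past the remaining factors without a sign and the terms of the
    product rule coincide. *)
Lemma ccontract_power X j F : parity 0 F ->
  ccontract X (wedge_power j.+1 F) = j.+1%:R *: wedge (ccontract X F) (wedge_power j F).
Proof.
move=> pF; elim: j => [|j IH].
  by rewrite /= !wedge_unitr scale1r.
rewrite [wedge_power _ _]/(wedge F (wedge_power j.+1 F)) ccontract_wedge IH pF scale1r.
rewrite wedgeZr [wedge F (wedge (ccontract X F) _)]wedgeA (wedgeC_even (ccontract X F) pF).
by rewrite -wedgeA -[j.+2]add1n natrD scalerDl scale1r.
Qed.

Lemma wedge_power_large j F : is_form F -> homogeneous 2 F -> (\dim {:V} < j * 2)%N ->
  wedge_power j F = 0.
Proof.
move=> fF hF lt; apply/funext => s; have [e|/eqP n] := eqVneq (size s) (j * 2)%N.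
  by apply: form_large_eq0; rewrite ?e //; apply: is_form_power.
exact: homogeneous_power n.
Qed.

(** Contraction shifts the exponential series by one index: the term of index j + 1 goes to [i_X F]
    times the term of index j. *)
Lemma ccontract_exp X F : is_form F -> homogeneous 2 F ->
  ccontract X (exp_form F) = wedge (ccontract X F) (exp_form F).
Proof.
move=> fF hF; rewrite /exp_form ccontract_sum wedge_sumr.
rewrite big_nat_recl // [RHS]big_nat_recr //= ccontractZ ccontract_unit scaler0 add0r.
(* The last term of the truncated series has no partner on the left. Its power of [F] exceeds the
   top degree, except for [V] of dimension 0, where the covector [i_X F] is itself zero. *)
have -> : wedge (ccontract X F) ((\dim {:V})`!%:R^-1 *: wedge_power (\dim {:V}) F) = 0.
  have [V0|V0] := posnP (\dim {:V}).
    have [xi ->] := ccontract_one_form X fF hF.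
    suff -> : one_form xi = 0 :> form by rewrite wedge0l.
    apply/funext => s; have [e|n] := eqVneq (size s) 1.
      by apply: form_large_eq0; rewrite ?e ?V0 //; apply: is_form_one.
    exact/homogeneous_one/eqP.
  by rewrite wedge_power_large ?scaler0 ?wedge0r //; lia.
rewrite addr0; apply: eq_bigr => j _.
rewrite ccontractZ ccontract_power; last exact: homogeneous2_parity.
rewrite scalerA wedgeZr; congr (_ *: _).
by rewrite factS natrM invfM mulrAC mulVf ?mul1r // pnatr_eq0.
Qed.

Lemma exp_form_nil F : homogeneous 2 F -> exp_form F [::] = 1.
Proof.
move=> hF; rewrite /exp_form fct_sumE big_nat_recl // big1_seq ?addr0.
  by rewrite scalrfctE /= /unit_form eqxx fact0 invr1 scale1r.
by move=> j _; rewrite scalrfctE (homogeneous_power hF) ?scaler0.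
Qed.

Lemma parity_exp F : homogeneous 2 F -> parity 0 (exp_form F).
Proof.
move=> /homogeneous2_parity pF; rewrite /parity /exp_form scale1r.
rewrite (big_morph signed signedD (_ : signed 0 = 0)); last first.
  by apply/funext => s; rewrite /signed mulr0.
by apply: eq_bigr => j _; rewrite signedZ parity_power // scale1r.
Qed.

Lemma clifford_exp v F xi th : is_form F -> homogeneous 2 F ->
  ccontract (cvec v) F = one_form xi ->
  clifford v (wedge (exp_form F) (wedge_one_forms th)) =
  wedge (exp_form F) (ccontract (cvec v) (wedge_one_forms th)
    + wedge (one_form (xi + ccov v)) (wedge_one_forms th)).
Proof.
move=> fF hF e; rewrite /clifford ccontract_wedge ccontract_exp // e parity_exp //.
rewrite scale1r one_formD wedgeDl !wedgeDr !wedgeA.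
rewrite -!(wedgeC_even (one_form _) (parity_exp hF)).
by rewrite [RHS]addrCA -addrA.
Qed.

Lemma clifford_eq0 v F xi th : is_form F -> homogeneous 2 F -> free th ->
  ccontract (cvec v) F = one_form xi ->
  clifford v (wedge (exp_form F) (wedge_one_forms th)) = 0 <->
  cvec v \in coann <<th>>%VS /\ xi + ccov v \in <<th>>%VS.
Proof.
move=> fF hF fth e; rewrite (clifford_exp _ fF hF e) -(ccontract_eq0 _ fth) -wedge_one_eq0 //.
split=> [/(wedge_unipotent_eq0 (exp_form_nil hF)) H|[-> ->]]; last by rewrite addr0 wedge0r.
have hc := homogeneous_ccontract (cvec v) (@homogeneous_wedge_one_forms _ _ th).
have hw : homogeneous (size th).+1 (wedge (one_form (xi + ccov v)) (wedge_one_forms th)).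
  apply: (homogeneous_wedge (p := 1)); first exact: homogeneous_one.
  exact: homogeneous_wedge_one_forms.
(* The wedge term sits in degree [(size th).+1], where the contraction, of degree [(size th).-1],
   contributes nothing. *)
suff w0 : wedge (one_form (xi + ccov v)) (wedge_one_forms th) = 0.
  by split=> //; rewrite w0 addr0 in H.
apply/funext => s; have [es|/eqP/hw//] := eqVneq (size s) (size th).+1.
by have /(congr1 (@^~ s)) := H; rewrite addrfctE hc ?add0r //; lia.
Qed.

Lemma spinor_neq0 F th : homogeneous 2 F -> free th ->
  wedge (exp_form F) (wedge_one_forms th) <> 0.
Proof. by move=> hF fth /(wedge_unipotent_eq0 (exp_form_nil hF)) /wedge_one_forms_neq0; apply. Qed.

Lemma is_form_spinor F th : is_form F ->
  is_form (wedge (exp_form F) (wedge_one_forms th)).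
Proof. by move=> fF; apply/is_form_wedge/is_form_wedge_one_forms/is_form_exp. Qed.
End Spinors.

(** * Euler's identity and forms of top degree *)

Section RealStructure.
Context {R : rcfType} {V : vectType R}.
Local Notation Vd := 'Hom(V, R^o).
Local Notation form := (seq V -> R[i]).
Implicit Types (a b c phi psi F omega rho : form) (x y : V) (s t : seq V).
Implicit Types (xi eta : complexify Vd) (X Y : complexify V).
Implicit Types (th : seq (complexify Vd)).
Implicit Types (S : {vspace complexify Vd}).

Lemma contract_swap phi x y : is_form phi ->
  contract x (contract y phi) = - contract y (contract x phi).
Proof.
move=> fphi; apply/funext => s; rewrite opprfctE.
have := is_form_contract2 (1 *: x + y) fphi.
rewrite is_form_linear; last exact: is_form_contract.
rewrite !is_form_linear // !contractD !contractZ !is_form_contract2 //.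
rewrite !scaler0 add0r addr0 !scale1r => /(congr1 (@^~ s)) /eqP.
by rewrite addrfctE addr_eq0 => /eqP.
Qed.

Definition dual_covector (i : 'I_(\dim {:V})) : complexify Vd :=
  Cplx (linfun (coord (vbasis {:V}) i : V -> R^o)) 0.

Lemma dual_covectorE i : one_form (dual_covector i) [:: (vbasis {:V})`_i] = 1.
Proof.
apply/eqP; rewrite eq_complex /= !lfunE /= (coord_free _ _ (basis_free (vbasisP _))).
by rewrite !eqxx.
Qed.

Lemma wedge_one_contract xi y rho s :
  wedge (one_form xi) rho (y :: s) =
  one_form xi [:: y] * rho s - wedge (one_form xi) (contract y rho) s.
Proof.
rewrite wedge_cons signed_one wedgeNl; congr (_ + _).
have -> : contract y (one_form xi) = one_form xi [:: y] *: unit_form.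
  by apply/funext => -[|z t]; rewrite scalrfctE /unit_form /contract /GRing.scale /= ?mulr1 ?mulr0.
by rewrite wedgeZl wedge_unitl.
Qed.

(* Euler's identity: [\sum_i e^i /\ i_(e_i)] multiplies a form by its degree. *)
Lemma euler_form rho s : is_form rho ->
  (\sum_i wedge (one_form (dual_covector i)) (contract (vbasis {:V})`_i rho)) s
  = (size s)%:R * rho s.
Proof.
elim: s rho => [|y s IH] rho frho; rewrite fct_sumE.
  by rewrite big1 ?mul0r // => i _; rewrite wedge_nil mul0r.
under eq_bigr do rewrite wedge_one_contract contract_swap // wedgeNr opprfctE opprK.
have := IH _ (is_form_contract y frho); rewrite fct_sumE big_split /= => ->.
rewrite -[(size s).+1]add1n natrD mulrDl mul1r; congr (_ + _).
rewrite -[RHS]/(contract y rho s) [in RHS](coord_vbasis (memvf y)) is_form_contract_sum // fct_sumE.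
by apply: eq_bigr => i _; rewrite scalrfctE !lfunE.
Qed.

(** Contracting [e^i /\ rho = 0] with [e_i] gives [e^i /\ i_(e_i) rho = rho] for each i. Summed over
    i, Euler's identity turns this into [p rho = (dim V) rho], where [p < dim V]. *)
Lemma wedge_one_all_eq0 p rho : is_form rho -> homogeneous p rho -> (p < \dim {:V})%N ->
  (forall xi, wedge (one_form xi) rho = 0) -> rho = 0.
Proof.
move=> frho hrho lt H; apply/funext => s; have [e|/eqP/hrho//] := eqVneq (size s) p.
have := euler_form s frho; rewrite fct_sumE.
under eq_bigr => i _.
  have := wedge_one_contract (dual_covector i) (vbasis {:V})`_i rho s.
  rewrite H => /esym/eqP; rewrite subr_eq0 => /eqP <-.
  rewrite dual_covectorE mul1r.
  over.
rewrite sumr_const card_ord -[LHS]mulr_natl e => /eqP; rewrite -subr_eq0 -mulrBl.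
rewrite -natrB; last exact: ltnW.
by rewrite mulf_eq0 pnatr_eq0 subn_eq0 leqNgt lt => /eqP.
Qed.

(** For a covector [f] with [f(x)] nonzero, [f /\ rho] vanishes by degree; contracting it with [x]
    gives [f(x) rho = f /\ i_x rho = 0]. *)
Lemma contract_top_eq0 x rho : is_form rho -> homogeneous (\dim {:V}) rho -> x != 0 ->
  contract x rho = 0 -> rho = 0.
Proof.
move=> frho hrho x0 c0.
have [f fx] : exists f : Vd, f x <> 0.
  by apply/not_existsP => H; case/eqP: x0; apply: real_covector_sep => f; apply: contrapT; apply: H.
have w0 : wedge (one_form (Cplx f 0)) rho = 0.
  apply/funext => s; have hw := homogeneous_wedge (@homogeneous_one _ _ (Cplx f 0)) hrho.
  have [e|/eqP/hw//] := eqVneq (size s) (1 + \dim {:V})%N.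
  by apply: form_large_eq0; rewrite ?e //; apply: is_form_wedge => //; apply: is_form_one.
apply/funext => s; have := wedge_one_contract (Cplx f 0) x rho s.
rewrite w0 c0 wedge0r subr0 => /esym/eqP; rewrite mulf_eq0 => /orP[|/eqP//].
by rewrite /= lfunE eq_complex /= => /andP[/eqP].
Qed.

(** * Conjugation *)

Lemma conj_wedge a b : conj_form (wedge a b) = wedge (conj_form a) (conj_form b).
Proof.
apply/funext => s; rewrite /conj_form /wedge rmorph_sum; apply: eq_bigr => m _.
by rewrite !rmorphM rmorphXn rmorphN1.
Qed.

Lemma conj_wedge_one_forms th :
  conj_form (wedge_one_forms th) = wedge_one_forms [seq cconj xi | xi <- th] :> form.
Proof.
elim: th => [|xi th IH] /=.
  by apply/funext => s; rewrite /conj_form /unit_form rmorph_nat.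
rewrite conj_wedge IH; congr wedge.
apply/funext => -[|x [|y s]]; apply/eqP; rewrite eq_complex /= ?oppr0 ?lfunE /= !eqxx //.
Qed.

(** Independence is detected by the wedge product of the covectors, and conjugation commutes with
    that product. *)
Lemma free_cconj th : free th -> free [seq cconj xi | xi <- th].
Proof.
move=> fth; apply: contraT => /wedge_one_forms_eq0; rewrite -conj_wedge_one_forms => e.
case: (wedge_one_forms_neq0 fth); apply/funext => s.
by have /(congr1 (@^~ s)) /eqP := e; rewrite /conj_form fmorph_eq0 => /eqP.
Qed.

Lemma spanv_cconj th xi :
  (xi \in <<[seq cconj eta | eta <- th]>>%VS) = (cconj xi \in <<th>>%VS).
Proof.
apply/idP/idP => [/cconj_span|h]; first by rewrite -map_comp (eq_map cconjK) map_id.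
by rewrite -[xi]cconjK; apply: cconj_span.
Qed.

(** Such spaces are the complexifications of real ones; their annihilators can be tested on real
    vectors. *)
Definition conj_closed S := forall xi, xi \in S -> cconj xi \in S.

Definition cat_cconj th := th ++ [seq cconj xi | xi <- th].

Lemma conj_closed_cat th : conj_closed <<cat_cconj th>>%VS.
Proof.
move=> xi; rewrite /cat_cconj span_cat => /memv_addP[u uth [v vth ->]].
by rewrite cconjD addrC memv_add ?spanv_cconj ?cconjK // -spanv_cconj.
Qed.

Lemma ceval0r xi : ceval xi 0 = 0.
Proof. by rewrite /ceval /= !raddf0 addr0. Qed.

(** Every [xi] in [S] vanishes at [X], and also at the conjugate of [X] because the conjugate of
    [xi] lies in [S]; hence it vanishes at the real and imaginary parts. *)
Lemma coann_cre_cim S X : conj_closed S -> X \in coann S ->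
  Cplx (cre X) 0 \in coann S /\ Cplx (cim X) 0 \in coann S.
Proof.
move=> cS /mem_coann XS.
have H xi : xi \in S -> ceval xi (Cplx (cre X) 0) = 0 /\ ceval xi (Cplx (cim X) 0) = 0.
  move=> xiS; have := XS _ xiS; have := XS _ (cS _ xiS).
  case: X {XS} => x y /=; rewrite -[X in ceval _ X]cconjK ceval_conj => /eqP.
  rewrite fmorph_eq0 /cconj /= => /eqP; rewrite (ceval_real xi x y) (ceval_real xi x (- y)).
  have -> : ceval xi (Cplx (- y) 0) = - ceval xi (Cplx y 0).
    by rewrite /ceval /= !raddf0 !raddfN !addr0 !add0r.
  move: (ceval _ _) (ceval _ _) => a b; rewrite mulrN => /eqP; rewrite subr_eq0 => /eqP ->.
  rewrite -mulr2n => /eqP; rewrite mulrn_eq0 /= => /eqP b0; split=> //.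
  move/eqP: b0; rewrite mulf_eq0 => /orP[|/eqP //].
  by rewrite eq_complex /= oner_eq0 andbF.
by split; apply/mem_coann => xi /H[].
Qed.

Lemma form_kerP th x : free th ->
  form_ker (wedge_one_forms th : form) x <-> Cplx x 0 \in coann <<th>>%VS.
Proof.
move=> fth; rewrite -ccontract_eq0 // ccontract_real //.
exact: is_form_wedge_one_forms.
Qed.

Lemma real_form_val p omega s : real_form p omega -> exists r : R, omega s = r%:C%C.
Proof.
case=> _ _ /(congr1 (@^~ s)); rewrite /conj_form; case: (omega s) => u v [/eqP].
by rewrite eq_sym -addr_eq0 -mulr2n mulrn_eq0 => /eqP ->; exists u.
Qed.

Lemma real_contract omega x : real_form 2 omega ->
  exists w : Vd, contract x omega = one_form (Cplx w 0).
Proof.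
move=> romega; have [fo ho _] := romega.
have [xi e] := one_formP (is_form_contract x fo) (homogeneous_contract x ho).
exists (cre xi); rewrite e; congr one_form; case: xi e => f g e.
congr Cplx; apply/lfunP => y; rewrite lfunE /=.
have [r] := real_form_val [:: x; y] romega.
by have /(congr1 (@^~ [:: y])) := e; rewrite /contract /= => -> [].
Qed.

(** Otherwise a complex vector annihilated by the span separates [xi] from it; its real and
    imaginary parts lie in the kernel of the product, where [i_x omega] vanishes. *)
Lemma contract_omega_mem_span th omega x : free th -> conj_closed <<th>>%VS ->
  (forall y, form_ker (wedge_one_forms th : form) y -> omega [:: x; y] = 0) ->
  forall xi, contract x omega = one_form xi -> xi \in <<th>>%VS.
Proof.
move=> fth cth H xi e; apply: contraT => /coann_sep[X Xth /eqP[]].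
have [/(form_kerP _ fth) /H hr /(form_kerP _ fth) /H hi] := coann_cre_cim cth Xth.
case: X hr hi {Xth} => y z /= hr hi; rewrite (ceval_real xi y z) !cevalE -e /contract hr hi.
by rewrite mulr0 addr0.
Qed.

(** Applied with [th] the theta's and their conjugates and [m = n - k]. The dimension equation puts
    the product in top degree, where it vanishes as soon as [i_x] kills it. *)
Lemma wedge_power_degenerate th omega m x : free th -> conj_closed <<th>>%VS ->
  is_form omega -> homogeneous 2 omega -> (m * 2 + size th)%N = \dim {:V} ->
  form_ker (wedge_one_forms th : form) x ->
  (forall y, form_ker (wedge_one_forms th : form) y -> omega [:: x; y] = 0) -> x != 0 ->
  wedge (wedge_power m omega) (wedge_one_forms th) = 0.
Proof.
move=> fth cth fo ho sz kx deg x0.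
have fT : is_form (wedge (wedge_power m omega) (wedge_one_forms th)).
  by apply: is_form_wedge (is_form_wedge_one_forms _); apply: is_form_power.
apply: (contract_top_eq0 fT _ x0).
  rewrite -sz; apply: homogeneous_wedge (@homogeneous_wedge_one_forms _ _ _).
  exact: homogeneous_power.
have px : contract x (wedge_one_forms th : form) = 0 by [].
have po := homogeneous2_parity ho.
rewrite -ccontract_real // ccontract_wedge (parity_power _ po) scale1r.
rewrite [X in _ + wedge _ X]ccontract_real ?px ?wedge0r ?addr0; last exact: is_form_wedge_one_forms.
case: m {sz fT} => [|m]; first by rewrite ccontract_unit wedge0l.
rewrite ccontract_power // wedgeZl ccontract_real //.
have [xi e] := one_formP (is_form_contract x fo) (homogeneous_contract x ho).
rewrite e -(wedgeC_even _ (parity_power m po)) -wedgeA wedge_one_span ?wedge0r ?scaler0 //.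
exact: contract_omega_mem_span e.
Qed.

(** * Real kernels *)

Lemma eval_linear x : linear (fun f : Vd => f x : R^o).
Proof. by move=> k f h; rewrite !lfunE /= lfunE. Qed.

(** The kernel [Delta] as a subspace, cut out by real covectors, so that it has a dimension and a
    basis; [form_ker] is only a set. *)
Definition real_kernel th : {vspace V} :=
  @perp R V Vd (fun x f => f x) (fun f k x y => linearP f k x y)
    <<[seq cre xi | xi <- th] ++ [seq cim xi | xi <- th]>>%VS.

Lemma mem_coann_span th X :
  X \in coann <<th>>%VS <-> forall xi, xi \in th -> ceval xi X = 0.
Proof.
rewrite mem_coann; split=> H xi xith; first exact/H/memv_span.
rewrite (coord_span (X := in_tuple th) xith); elim/big_rec: _ => [|i eta _ IH].
  by rewrite /ceval /= !lfunE /= subrr addr0.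
rewrite [LHS](ceval_linearl X) IH addr0 H ?scaler0 //; exact: mem_nth.
Qed.

Lemma mem_real_kernel th x : x \in real_kernel th <-> Cplx x 0 \in coann <<th>>%VS.
Proof.
rewrite /real_kernel (mem_perp _ eval_linear) mem_coann_span; split=> H xi xith.
  rewrite cevalE /= !H //; apply: memv_span; rewrite mem_cat map_f ?orbT //.
have {}H eta : eta \in th -> cre eta x = 0 /\ cim eta x = 0.
  by move=> /H; rewrite cevalE /= => -[].
rewrite (coord_span (X := in_tuple _) xith) sum_lfunE big1 // => i _.
rewrite lfunE /=; set f := _`_i.
have : f \in [seq cre xi | xi <- th] ++ [seq cim xi | xi <- th] by apply: mem_nth.
by rewrite mem_cat => /orP[] /mapP[eta /H[h1 h2] ->]; rewrite ?h1 ?h2 scaler0.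
Qed.

(** [W'] is the complex span of a real basis of [W]; it serves to compare complex dimensions with
    real ones. *)
Lemma dim_complex_span (E : vectType R) (W : {vspace E}) :
  {W' : {vspace complexify E} | (\dim W' <= \dim W)%N &
    forall X : complexify E, cre X \in W -> cim X \in W -> X \in W'}.
Proof.
exists <<[seq Cplx u 0%R | u <- vbasis W]>>%VS.
  by apply: leq_trans (dim_span _) _; rewrite size_map size_tuple.
have H u : u \in W -> Cplx u 0 \in <<[seq Cplx u 0%R | u <- vbasis W]>>%VS.
  move=> /coord_vbasis ->; elim/big_rec: _ => [|i y _ IH]; first exact: mem0v.
  have -> k (z t : E) : Cplx (k *: z + t) 0 = k%:C%C *: Cplx z 0 + Cplx t 0.
    by congr Cplx; rewrite /= ?scale0r ?scaler0 ?subr0 ?addr0.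
  by rewrite memvD // memvZ // memv_span // map_f // mem_nth // size_tuple.
move=> X /H Xr /H Xi; have -> : X = Cplx (cre X) 0 + 'i%C *: Cplx (cim X) 0.
  by case: X {Xr Xi} => x y; congr Cplx; rewrite /= ?scale0r ?scale1r ?scaler0 ?subr0 ?add0r ?addr0.
by rewrite memvD // memvZ.
Qed.

(** For one inequality, the theta's lie in the complex span of their real and imaginary parts, so
    these span at least [size th] real dimensions. For the other, closure under conjugation puts
    [coann] of the span inside the complex span of the real kernel. *)
Lemma dim_real_kernel th : free th -> conj_closed <<th>>%VS ->
  (\dim (real_kernel th) + size th)%N = \dim {:V}.
Proof.
move=> fth cth; apply/eqP; rewrite eqn_leq; apply/andP; split.
  pose S := <<[seq cre xi | xi <- th] ++ [seq cim xi | xi <- th]>>%VS.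
  have e : (\dim (real_kernel th) + \dim S)%N = \dim {:V}.
    apply: (dim_perp _ eval_linear) => [x|]; first exact: real_covector_sep.
    by rewrite !dimvf /dim /= muln1.
  rewrite -e leq_add2l; have [W' dW' W'P] := dim_complex_span S.
  apply: leq_trans dW'; rewrite -(eqP fth); apply/dimvS/span_subvP => xi xith.
  by apply: W'P; apply: memv_span; rewrite mem_cat map_f ?orbT.
rewrite -(dim_coann <<th>>%VS) (eqP fth) leq_add2r.
have [W' dW' W'P] := dim_complex_span (real_kernel th).
apply: leq_trans dW'; apply/dimvS/subvP => X Xth.
by have [h1 h2] := coann_cre_cim cth Xth; apply: W'P; apply/mem_real_kernel.
Qed.

(** Induction on [j]; the degree bound at [j.+1] keeps the product at [j] below top degree, as
    Euler's identity demands. *)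
Lemma wedge_power_nondegenerate th omega j : free th -> conj_closed <<th>>%VS ->
  real_form 2 omega -> nondegenerate_on (form_ker (wedge_one_forms th : form)) omega ->
  (j * 2 + size th <= \dim {:V})%N ->
  wedge (wedge_power j omega) (wedge_one_forms th) <> 0.
Proof.
move=> fth cth romega nd; have [fo ho _] := romega; have po := homogeneous2_parity ho.
elim: j => [_|j IH le t0]; first by rewrite wedge_unitl; apply: wedge_one_forms_neq0.
have {}IH : wedge (wedge_power j omega) (wedge_one_forms th) <> 0 by apply: IH; lia.
apply: IH; set rho := wedge _ _.
apply: (@wedge_one_all_eq0 (j * 2 + size th)); last first.
- have [al alP] := choice (fun x => real_contract x romega).
  (* Covectors that wedge [rho] to zero: those of [th], already factors of [rho], and [i_x omega]
     for [x] in the kernel, seen by contracting the vanishing product with [x]. *)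
  pose l := th ++ [seq Cplx (al x) 0 | x <- vbasis (real_kernel th)].
  have lw xi : xi \in l -> wedge (one_form xi) rho = 0.
    rewrite mem_cat => /orP[xith|/mapP[x xk ->]].
      rewrite /rho (wedgeC_even _ (parity_power j po)) wedgeA.
      by rewrite wedge_one_mem // wedge0l.
    have kx : x \in real_kernel th by apply: vbasis_mem.
    have px : contract x (wedge_one_forms th : form) = 0.
      by apply/(form_kerP _ fth)/mem_real_kernel.
    have : ccontract (Cplx x 0) (wedge (wedge_power j.+1 omega) (wedge_one_forms th)) = 0.
      by rewrite t0 ccontract0.
    rewrite ccontract_wedge ccontract_power // (parity_power _ po) scale1r.
    rewrite !ccontract_real ?px ?wedge0r ?addr0 //; last exact: is_form_wedge_one_forms.
    rewrite wedgeZl -wedgeA alP => /eqP; rewrite scaler_eq0 pnatr_eq0 /=.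
    by move/eqP.
  move=> xi; apply: (wedge_one_span_eq0 lw).
  (* These covectors span the whole dual: a vector annihilated by all of them has its real and
     imaginary parts in the kernel and [omega]-orthogonal to it, hence zero. *)
  apply: contraT => /coann_sep[X Xl /eqP[]].
  have Xth : X \in coann <<th>>%VS.
    by apply/mem_coann_span => eta e; apply: (mem_coann_span _ _).1 Xl _ _; rewrite mem_cat e.
  have H x : x \in vbasis (real_kernel th) -> omega [:: x; cre X] = 0 /\ omega [:: x; cim X] = 0.
    move=> xk; have /(mem_coann_span _ _).1 /(_ (Cplx (al x) 0)) := Xl.
    rewrite mem_cat map_f ?orbT // => /(_ isT).
    have e y : omega [:: x; y] = (al x y)%:C%C.
      by have /(congr1 (@^~ [:: y])) := alP x; rewrite /contract /= lfunE.
    by rewrite /ceval /= !lfunE /= subr0 addr0 !e => -[-> ->].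
  have [kr ki] := coann_cre_cim cth Xth.
  have nd' y : Cplx y 0 \in coann <<th>>%VS ->
      (forall x, x \in vbasis (real_kernel th) -> omega [:: x; y] = 0) -> y = 0.
    move=> ky Hy; apply: nd; first exact/form_kerP.
    move=> z /(form_kerP _ fth) /mem_real_kernel /coord_vbasis ez.
    have /(congr1 (@^~ [::])) := contract_swap z y fo; rewrite /contract opprfctE => ->.
    apply/eqP; rewrite oppr_eq0 ez -[omega _]/(contract _ omega [:: y]).
    rewrite is_form_contract_sum // fct_sumE big1 // => i _.
    by rewrite scalrfctE /contract Hy ?scaler0 // mem_nth // size_tuple.
  have -> : X = 0.
    case: X kr ki H {Xl Xth} => u v /= kr ki H; congr Cplx; apply: nd' => // x /H[] //.
  exact: ceval0r.
- by lia.
- apply: homogeneous_wedge; [exact: homogeneous_power|exact: homogeneous_wedge_one_forms].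
- by apply: is_form_wedge (is_form_wedge_one_forms _); apply: is_form_power.
Qed.

End RealStructure.

(** * Isotropic subspaces in terms of vector and covector components *)

Section MaximalIsotropic.
Context {R : rcfType} {V : vectType R}.
Local Notation Vd := 'Hom(V, R^o).
Local Notation T := (V * Vd)%type.
Local Notation form := (seq V -> R[i]).
Implicit Types (a b c phi psi F B omega rho : form) (x y : V) (s t : seq V).
Implicit Types (xi eta : complexify Vd) (X Y : complexify V).
Implicit Types (th : seq (complexify Vd)) (L : {vspace complexify T}).

Fact ccov_linear : linear (@ccov R V).
Proof. by []. Qed.
HB.instance Definition _ :=
  GRing.isLinear.Build R[i] (complexify T) (complexify Vd) _ (@ccov R V) ccov_linear.

Lemma lfun_cvec v : linfun (@cvec R V) v = cvec v.
Proof. exact: lfunE. Qed.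

Lemma lfun_ccov v : linfun (@ccov R V) v = ccov v.
Proof. exact: lfunE. Qed.

Lemma cvec_ccov_inj (u v : complexify T) : cvec u = cvec v -> ccov u = ccov v -> u = v.
Proof. by case: u v => [[x f] [y g]] [[x' f'] [y' g']] [-> ->] [-> ->]. Qed.

Lemma cpairingE (v w : complexify T) :
  cpairing v w = 2^-1%:C%C * (ceval (ccov v) (cvec w) + ceval (ccov w) (cvec v)).
Proof.
rewrite /cpairing /pairing /ceval /=; apply/eqP; rewrite eq_complex /=.
by apply/andP; split; apply/eqP; ring.
Qed.

Lemma isotropic_ceval L v w : isotropic L -> v \in L -> w \in L ->
  ceval (ccov v) (cvec w) = - ceval (ccov w) (cvec v).
Proof.
move=> iL vL wL; have /eqP := iL v w vL wL; rewrite cpairingE mulf_eq0 => /orP[|].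
  by rewrite eq_complex /= invr_eq0 pnatr_eq0.
by rewrite addr_eq0 => /eqP.
Qed.

(** * The real index *)

(** Twice the real and imaginary parts of [v] are [v + cconj v] and [-i (v - cconj v)], which are
    real vectors of [W]. *)
Lemma conj_fixed_eq0 (E : vectType R) (W : {vspace complexify E}) :
  (forall x : E, Cplx x 0 \in W -> x = 0) -> forall v, v \in W -> cconj v \in W -> v = 0.
Proof.
move=> H v vW cW; have two0 (u : E) : u *+ 2 = 0 -> u = 0.
  by move/eqP; rewrite -scaler_nat scaler_eq0 pnatr_eq0 => /eqP.
have e1 : Cplx (cre v *+ 2) 0 = v + cconj v.
  by case: v {vW cW} => a b; congr Cplx; rewrite /= ?addrN.
have e2 : Cplx (cim v *+ 2) 0 = - 'i%C *: (v - cconj v).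
  have -> : v - cconj v = Cplx 0 (cim v *+ 2).
    by case: v {vW cW e1} => a b; congr Cplx; rewrite /= ?subrr ?opprK.
  by congr Cplx; rewrite /= ?oppr0 ?scaler0 ?scale0r ?scaleN1r ?opprK ?add0r ?addr0.
case: v vW cW e1 e2 => a b vW cW /= e1 e2; congr Cplx; apply/two0/H.
  by rewrite e1 memvD.
by rewrite e2 memvZ // memvB.
Qed.

Lemma contract0_one phi : is_form phi -> contract 0 phi = one_form (Cplx 0 0).
Proof.
move=> fphi; rewrite is_form_contract0 //.
by apply/funext => -[|y [|z s]] //=; rewrite !lfunE.
Qed.

Lemma real_index_eq0 L :
  real_index L = 0%N <-> forall t : T, Cplx t 0 \in L -> t = 0.
Proof.
rewrite /real_index; split=> [/eqP|H].
  rewrite dimv_eq0 => /eqP L0 t tL.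
  have : Cplx t 0 \in (L :&: conjv L)%VS.
    by rewrite memv_cap memv_conj /cconj /= oppr0 tL.
  by rewrite L0 memv0 => /eqP [].
apply/eqP; rewrite dimv_eq0 -subv0; apply/subvP => v /memv_capP[vL].
by rewrite memv_conj memv0 => cvL; apply/eqP; apply: conj_fixed_eq0 H _ vL cvL.
Qed.

(** * Type and real index of the annihilator of a given spinor *)

Section Spinor.
Context (L : {vspace complexify T}) (B omega : form) (th : seq (complexify Vd)).
Context (rB : real_form 2 B) (romega : real_form 2 omega) (fth : free th).
Let F : form := B + 'i%C *: omega.
Context (LP : forall v, v \in L <-> clifford v (wedge (exp_form F) (wedge_one_forms th)) = 0).

Let fF : is_form F.
Proof. by case: rB romega => [fB _ _] [fo _ _]; apply/is_formD/is_formZ. Qed.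

Let hF : homogeneous 2 F.
Proof. by case: rB romega => [_ hB _] [_ ho _]; apply/homogeneousD/homogeneousZ. Qed.

Lemma spinor_memP v xi : ccontract (cvec v) F = one_form xi ->
  v \in L <-> cvec v \in coann <<th>>%VS /\ xi + ccov v \in <<th>>%VS.
Proof. by move=> e; rewrite LP; apply: clifford_eq0. Qed.

(** The real covector [f] shifts only the real part, so the constraint on [x], beyond annihilation
    by the theta's, is that [i_x omega] be the imaginary part of a covector in their span. *)
Lemma spinor_real_memP x f g w :
  contract x B = one_form (Cplx g 0) -> contract x omega = one_form (Cplx w 0) ->
  Cplx (x, f) 0 \in L <-> Cplx x 0 \in coann <<th>>%VS /\ Cplx (g + f) w \in <<th>>%VS.
Proof.
move=> eB eo; have e : ccontract (cvec (Cplx (x, f) 0)) F = one_form (Cplx g w).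
  rewrite ccontract_real // contractD contractZ eB eo addrC -one_form_linear.
  congr one_form; congr Cplx;
    by rewrite /= ?scale0r ?scale1r ?scaler0 ?subr0 ?add0r ?addr0.
rewrite (spinor_memP e); set u := _ + _; suff -> : u = Cplx (g + f) w by [].
by congr Cplx; rewrite /= addr0.
Qed.

(** The projection of [L] is the annihilator of the theta's: each [X] in it lifts to [X - i_X F],
    whose covector condition is trivial. *)
Lemma spinor_type : isotropic_type L = size th.
Proof.
rewrite /isotropic_type; have -> : (linfun (@cvec R V) @: L)%VS = coann <<th>>.
  apply/eqP; rewrite eqEsubv; apply/andP; split; apply/subvP => X.
    move=> /memv_imgP[v vL ->]; rewrite lfun_cvec.
    have [xi e] := ccontract_one_form (cvec v) fF hF.
    by have [] := (spinor_memP e).1 vL.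
  move=> Xth; have [xi e] := ccontract_one_form X fF hF.
  pose v : complexify T := Cplx (cre X, - cre xi) (cim X, - cim xi).
  have vX : cvec v = X by case: X {Xth e} @v.
  have vL : v \in L.
    apply/(spinor_memP (xi := xi)); rewrite vX //; split=> //.
    have -> : xi + ccov v = 0 by congr Cplx; rewrite /= subrr.
    exact: mem0v.
  by apply/memv_imgP; exists v; rewrite // lfun_cvec vX.
by rewrite dim_complexify -(dim_coann <<th>>%VS) (eqP fth) addKn.
Qed.

Lemma spinor_real_index :
  real_index L = 0%N <-> free (cat_cconj th) /\
    nondegenerate_on (form_ker (wedge_one_forms (cat_cconj th) : form)) omega.
Proof.
rewrite real_index_eq0.
have cc := @conj_closed_cat R V th.
have thS xi : xi \in <<th>>%VS -> xi \in <<cat_cconj th>>%VS.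
  by move=> h; rewrite span_cat (subvP (addvSl _ _)).
split=> [H|[fcc nd] [x f]].
  have fcc : free (cat_cconj th).
    rewrite cat_free fth free_cconj //=; apply/directv_addP/eqP.
    rewrite -subv0; apply/subvP => xi /memv_capP[xith]; rewrite spanv_cconj => cth.
    have real0 f : Cplx f 0 \in <<th>>%VS -> f = 0.
      move=> fS; suff : (0 : V, f) = 0 :> T by case.
      apply: H.
      have [fB _ _] := rB; have [fo _ _] := romega.
      apply/(spinor_real_memP f (contract0_one fB) (contract0_one fo)); rewrite add0r; split=> //.
      exact: mem0v.
    by rewrite memv0; apply/eqP; apply: conj_fixed_eq0 real0 _ xith cth.
  split=> // x kx Hx.
  have [w ew] := real_contract x romega; have [g eg] := real_contract x rB.
  have wS := contract_omega_mem_span fcc cc Hx ew.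
  have := memvZ 'i%C wS; rewrite span_cat => /memv_addP[u uS [v]].
  rewrite spanv_cconj => vS e.
  (* [i w = u + v] with [u] in the span of theta and [v] in its conjugate; then
     [u - cconj v] is in the span and still has imaginary part [w]. *)
  have e' : u - cconj v = Cplx (cre u - cre v) w.
    have /(congr1 (fun z : complexify Vd => cim z)) := e; rewrite /= scaler0 scale1r add0r => ->.
    by congr Cplx; rewrite /= opprK.
  suff : (x, cre u - cre v - g) = 0 :> T by case.
  apply: H; apply/(spinor_real_memP _ eg ew); rewrite addrC subrK -e' memvB //; split=> //.
  apply/mem_coann => xi xith; move/(form_kerP _ fcc)/mem_coann: kx; apply.
  exact: thS.
move=> xL; have [w ew] := real_contract x romega; have [g eg] := real_contract x rB.
have [xth gS] := (spinor_real_memP f eg ew).1 xL.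
have kerS y : Cplx y 0 \in coann <<th>>%VS -> Cplx y 0 \in coann <<cat_cconj th>>%VS.
  move=> /mem_coann ky; apply/mem_coann_span => xi; rewrite mem_cat => /orP[/memv_span/ky//|].
  move=> /mapP[eta /memv_span/ky e ->].
  have -> : Cplx y 0 = cconj (Cplx y 0) by congr Cplx; rewrite /= oppr0.
  by rewrite ceval_conj e rmorph0.
(* A covector in the span vanishes on [Delta], and so does its imaginary part [i_x omega]; thus [x]
   lies in the radical. *)
have x0 : x = 0.
  apply: nd; first exact/form_kerP/kerS.
  move=> y /(form_kerP _ fcc)/mem_coann ky.
  have := ky _ (thS _ gS); rewrite cevalE => -[_ wy].
  have /(congr1 (@^~ [:: y])) := ew; rewrite /contract /= lfunE wy => ->.
  by [].
have [fB _ _] := rB; have [fo _ _] := romega.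
(* With [x = 0] the real covector [f] lies in the span of the theta's, hence also in that of their
   conjugates, and independence kills it. *)
rewrite x0 in xL *; have [_] := (spinor_real_memP f (contract0_one fB) (contract0_one fo)).1 xL.
rewrite add0r => fS; congr pair; apply/eqP.
have : Cplx f 0 \in (<<th>> :&: <<[seq cconj xi | xi <- th]>>)%VS.
  by rewrite memv_cap fS spanv_cconj /cconj /= oppr0.
move: fcc; rewrite cat_free => /and3P[_ _ /directv_addP ->].
by rewrite memv0 => /eqP[->].
Qed.

End Spinor.

(** The clause [k <= n] encodes the convention that the condition fails for [k > n], where [n - k]
    would truncate to 0. In the converse it follows from the independence of 2k covectors in
    dimension 2n. *)
Lemma nonvanishing_iff n k omega (th : seq (complexify Vd)) :
  \dim {:V} = (2 * n)%N -> size th = k -> real_form 2 omega ->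
  (k <= n)%N /\ wedge (wedge_power (n - k) omega) (wedge_one_forms (cat_cconj th)) <> 0 <->
  free (cat_cconj th) /\
    nondegenerate_on (form_ker (wedge_one_forms (cat_cconj th) : form)) omega.
Proof.
move=> dimV sth romega; have [fo ho _] := romega; have cc := @conj_closed_cat R V th.
have szc : size (cat_cconj th) = (2 * k)%N by rewrite size_cat size_map sth; lia.
split=> [[kn nz]|[fcc nd]].
  have fcc : free (cat_cconj th).
    by apply: contraT => /wedge_one_forms_eq0 e; case: nz; rewrite e wedge0r.
  split=> // x kx Hx; apply/eqP; apply: contraT => x0; case: nz.
  by apply: wedge_power_degenerate kx Hx x0 => //; lia.
have kn : (k <= n)%N.
  have : (2 * k <= 2 * n)%N; last by lia.
  by rewrite -szc -(eqP fcc) -dimV -dim_complexify -dim_cvec_ccov; apply: dimvS; apply: subvf.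
by split=> //; apply: wedge_power_nondegenerate => //; lia.
Qed.

(** * Existence of the pure spinor *)

Lemma real_two_form (f : V -> V -> R) :
  (forall (k : R) x y z, f (k *: x + y) z = k * f x z + f y z) ->
  (forall (k : R) x y z, f z (k *: x + y) = k * f z x + f z y) ->
  (forall x, f x x = 0) ->
  real_form 2 (fun s => if s is [:: x; y] then (f x y)%:C%C else 0).
Proof.
move=> fl fr fa; split.
- apply/is_formP; split.
    by move=> [|x [|y [|z s]]] k u v [|p [|q t]] //=; rewrite ?mulr0 ?addr0 //
      ?fl ?fr rmorphD rmorphM.
  by move=> [|x [|y [|z s]]] u [|p [|q t]] //=; rewrite fa.
- by move=> [|x [|y [|z s]]].
- apply/funext => -[|x [|y [|z s]]]; rewrite /conj_form ?rmorph0 //=.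
  by rewrite oppr0.
Qed.

Lemma coann_ann (E : {vspace complexify V}) : coann (ann E) = E.
Proof.
apply/eqP; rewrite eqEsubv; apply/andP; split; apply/subvP => X.
  move=> /mem_coann H; apply: contraT => /ann_sep[xi xiE].
  by rewrite H // eqxx.
by move=> XE; apply/mem_coann => xi /mem_ann; apply.
Qed.

Section Existence.
Context (L : {vspace complexify T}) (mL : maximal_isotropic L).
Let iL : isotropic L := mL.1.
Local Notation f := (linfun (@cvec R V)).
Let E := (f @: L)%VS.

(** A linear section of the projection, built from a pseudo-inverse; the outer [projv L] keeps its
    values in [L] even outside [E]. *)
Lemma lift_exists : {S : 'Hom(complexify V, complexify T) |
  (forall X, S X \in L) & (forall X, X \in E -> cvec (S X) = X)}.
Proof.
exists (projv L \o (f \o projv L)^-1)%VF => [X|X XE]; rewrite !comp_lfunE.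
  exact: memv_proj.
have : X \in limg (f \o projv L) by rewrite limg_comp limg_proj.
by move/limg_lfunVK; rewrite comp_lfunE lfun_cvec.
Qed.

(** By isotropy the elements of [L] with zero vector part have covectors in [ann E]; since
    [\dim L = \dim {:V}], a dimension count shows that they fill it. *)
Lemma isotropic_cov_mem u : cvec u = 0 -> ccov u \in ann E -> u \in L.
Proof.
move=> u0 uE; pose U := (L :&: lker f)%VS.
have imU : (linfun (@ccov R V) @: U)%VS = ann E.
  apply/eqP; rewrite eqEdim; apply/andP; split.
    apply/subvP => eta /memv_imgP[v /memv_capP[vL]]; rewrite memv_ker lfun_cvec => /eqP /= v0 ->.
    rewrite lfun_ccov; apply/mem_ann => Y /memv_imgP[w wL ->]; rewrite lfun_cvec.
    by rewrite (isotropic_ceval iL vL wL) v0 ceval0r oppr0.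
  have := limg_ker_dim (linfun (@ccov R V)) U.
  have -> : (U :&: lker (linfun (@ccov R V)) = 0)%VS.
    apply/eqP; rewrite -subv0; apply/subvP => v /memv_capP[/memv_capP[_ v0] v1].
    move: v0; rewrite memv_ker lfun_cvec => /eqP v0.
    move: v1; rewrite memv_ker lfun_ccov => /eqP v1.
    rewrite memv0; apply/eqP.
    exact: cvec_ccov_inj.
  rewrite dimv0 add0n => ->.
  by rewrite -(leq_add2r (\dim E)) (dim_ann E) -mL.2 -[leqLHS](limg_ker_dim f L).
move: uE; rewrite -imU => /memv_imgP[v /memv_capP[vL]].
rewrite memv_ker lfun_cvec => /eqP v0; rewrite lfun_ccov => e.
by rewrite (@cvec_ccov_inj u v) // u0 v0.
Qed.

Lemma pure_spinor_exists : exists B omega (th : (\dim (ann E)).-tuple (complexify Vd)),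
  [/\ real_form 2 B, real_form 2 omega, free th &
      pure_spinor L (wedge (exp_form (B + 'i%C *: omega)) (wedge_one_forms th))].
Proof.
have [S SL SE] := lift_exists.
(* [- G] is the 2-form determined by [L] on [E], extended to all complex vectors through the
   projection onto [E], which keeps it bilinear and alternating. *)
pose G X Y := ceval (ccov (S (projv E X))) (projv E Y).
have Gl k X Y Z : G (k *: X + Y) Z = k * G X Z + G Y Z.
  rewrite /G !linearP /=; exact: (ceval_linearl _ k).
have Gr k X Y Z : G Z (k *: X + Y) = k * G Z X + G Z Y.
  rewrite /G !linearP /=; exact: (ceval_linearr _ k).
have GC X Y : G X Y = - G Y X.
  rewrite /G -{1}(SE (projv E Y)) ?memv_proj //.
  by rewrite (isotropic_ceval iL) // SE ?memv_proj.
have Ga X : G X X = 0.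
  by apply/eqP; have /eqP := GC X X; rewrite -addr_eq0 -mulr2n mulrn_eq0.
(* [B] and [omega] are the real and imaginary parts of [- G] on real vectors. *)
pose re x y := complex.Re (- G (Cplx x 0) (Cplx y 0)).
pose im x y := complex.Im (- G (Cplx x 0) (Cplx y 0)).
have realD (k : R) x y : Cplx (k *: x + y) 0 = k%:C%C *: Cplx x 0 + Cplx y 0 :> complexify V.
  by congr Cplx; rewrite /= ?scale0r ?scaler0 ?subr0 ?addr0.
have rre : real_form 2 (fun s => if s is [:: x; y] then (re x y)%:C%C else 0).
  rewrite /re; apply: real_two_form => [k x y z|k x y z|x]; last by rewrite Ga oppr0.
    rewrite realD Gl; case: (G _ _) (G _ _) => a b [c d] /=; ring.
  rewrite realD Gr; case: (G _ _) (G _ _) => a b [c d] /=; ring.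
have rim : real_form 2 (fun s => if s is [:: x; y] then (im x y)%:C%C else 0).
  rewrite /im; apply: real_two_form => [k x y z|k x y z|x]; last by rewrite Ga oppr0.
    rewrite realD Gl; case: (G _ _) (G _ _) => a b [c d] /=; ring.
  rewrite realD Gr; case: (G _ _) (G _ _) => a b [c d] /=; ring.
move: rre rim; set B : form := fun s => _; set omega : form := fun s => _ => rre rim.
exists B, omega, (vbasis (ann E)).
have [fB hB _] := rre; have [fo ho _] := rim.
have fth : free (vbasis (ann E)) := basis_free (vbasisP _).
have fF : is_form (B + 'i%C *: omega) by apply/is_formD/is_formZ.
have hF : homogeneous 2 (B + 'i%C *: omega) by apply/homogeneousD/homogeneousZ.
split=> //; split=> //; [exact: is_form_spinor|exact: spinor_neq0|].
move=> v; have [xi e] := ccontract_one_form (cvec v) fF hF.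
rewrite (clifford_eq0 fF hF fth e) (span_basis (vbasisP _)) coann_ann.
have FE x y : (B + 'i%C *: omega) [:: x; y] = - G (Cplx x 0) (Cplx y 0).
  by rewrite [RHS]complexE.
have xiE Y : ceval xi Y = - G (cvec v) Y.
  have H y : ceval xi (Cplx y 0) = - G (cvec v) (Cplx y 0).
    rewrite cevalE -e ccontractE !FE.
    have cvecE : cvec v = 'i%C *: Cplx (cim (cvec v)) 0 + Cplx (cre (cvec v)) 0.
      by case: (cvec v) => p q; congr Cplx;
        rewrite /= ?scale0r ?scale1r ?scaler0 ?subr0 ?add0r ?addr0.
    by rewrite [in RHS]cvecE Gl; ring.
  case: Y => p q; rewrite (ceval_real xi p q) !H.
  have -> : Cplx p q = 'i%C *: Cplx q 0 + Cplx p 0.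
    by congr Cplx; rewrite /= ?scale0r ?scale1r ?scaler0 ?subr0 ?add0r ?addr0.
  by rewrite Gr opprD addrC mulrN.
(* On [E], [xi] is minus the covector part of the lift of [cvec v], so the two covectors compared
   here agree on [E]. *)
have key : cvec v \in E -> (xi + ccov v \in ann E <-> ccov (v - S (cvec v)) \in ann E).
  move=> vE; have ceq Y : Y \in E ->
      ceval (xi + ccov v) Y = ceval (ccov (v - S (cvec v))) Y.
    move=> YE; have := ceval_linearl Y 1 xi (ccov v); rewrite !scale1r => ->.
    have := ceval_linearl Y (-1) (ccov (S (cvec v))) (ccov v).
    have <- : ccov (v - S (cvec v)) = -1 *: ccov (S (cvec v)) + ccov v.
      by rewrite scaleN1r addrC.
    move=> ->.
    by rewrite xiE /G !projv_id // scaleN1r.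
  by rewrite !mem_ann; split=> H Y YE; [rewrite -ceq|rewrite ceq]; rewrite ?H.
split=> [vL|[vE]].
  have vE : cvec v \in E by apply/memv_imgP; exists v; rewrite ?lfun_cvec.
  split=> //; apply/(key vE)/mem_ann => Y /memv_imgP[w wL ->]; rewrite lfun_cvec.
  rewrite (isotropic_ceval iL _ wL) ?memvB // linearB /= SE // subrr.
  by rewrite ceval0r oppr0.
(* [v] is the lift of its vector part plus an element with zero vector part and covector in [ann E];
   both summands lie in [L]. *)
move=> /(key vE) h; rewrite -[v](subrK (S (cvec v))) memvD //.
by apply: isotropic_cov_mem => //; rewrite linearB /= SE // subrr.
Qed.

End Existence.
End MaximalIsotropic.

Unset Implicit Arguments.

Theorem theorem4p8 (R : realType) (V : vectType R) (n : nat)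
    (dimV : \dim {:V} = (2 * n)%N)
    (L : {vspace complexify (V * 'Hom(V, R^o))})
    (maxL : maximal_isotropic L) :
  (exists (k : nat) (B omega : seq V -> R[i])
          (theta : k.-tuple (complexify 'Hom(V, R^o))),
     [/\ real_form 2 B, real_form 2 omega, free theta &
         pure_spinor L
           (wedge (exp_form (B + 'i%C *: omega)) (wedge_one_forms theta))]) /\
  (forall (k : nat) (B omega : seq V -> R[i])
          (theta : k.-tuple (complexify 'Hom(V, R^o))),
     let Omega := wedge_one_forms theta in
     let OmegaOmegabar := wedge Omega (conj_form Omega) in
     let nonvanishing :=
       (k <= n)%N /\ wedge (wedge_power (n - k) omega) OmegaOmegabar <> 0 in
     let theta_independent :=
       free (theta ++ [seq cconj xi | xi <- theta]) in
     let Delta := form_ker OmegaOmegabar in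
     real_form 2 B -> real_form 2 omega -> free theta ->
     pure_spinor L (wedge (exp_form (B + 'i%C *: omega)) Omega) ->
     [/\ k = isotropic_type L,
         real_index L = 0%N <-> nonvanishing,
         nonvanishing <-> theta_independent /\ nondegenerate_on Delta omega &
         theta_independent ->
           exists2 D : {vspace V}, (forall x, x \in D <-> Delta x) &
             \dim D = (2 * n - 2 * k)%N]).
Proof.
split.
  have [B [omega [theta H]]] := pure_spinor_exists maxL.
  by exists (\dim (ann (linfun cvec @: L))), B, omega, theta.
move=> k B omega theta Omega OmegaOmegabar nonvanishing theta_independent Delta.
move=> rB romega ftheta [_ _ _ LP].
have OO : OmegaOmegabar = wedge_one_forms (cat_cconj theta).
  by rewrite /OmegaOmegabar conj_wedge_one_forms wedge_one_forms_cat.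
have nvP : nonvanishing <-> theta_independent /\ nondegenerate_on Delta omega.
  rewrite /nonvanishing /Delta OO; apply: nonvanishing_iff => //; exact: size_tuple.
split=> //.
- by rewrite (spinor_type rB romega ftheta LP) size_tuple.
- by rewrite nvP /Delta OO; apply: spinor_real_index LP.
- move=> fcc; have cc := @conj_closed_cat R V theta.
  exists (real_kernel (cat_cconj theta)) => [x|].
    by rewrite /Delta OO mem_real_kernel form_kerP.
  by rewrite -dimV -(dim_real_kernel fcc cc) size_cat size_map size_tuple mul2n -addnn addnK.
Qed.
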